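(* Assume that all ions have the same diameter. With the notation of the context, the linearized system, around the equilibrium solution, of the electrokinetic equations is $$\varepsilon^2\Delta\mathbf u^\varepsilon-\nabla P^\varepsilon=\mathbf f^*-\sum_{j=1}^Nz_jn_j^{0,\varepsilon}\nabla(\Phi_j^\varepsilon+\Psi^{ext,*})\quad\text{in }\Omega^\varepsilon,$$ $$\operatorname{div}\mathbf u^\varepsilon=0\ \text{ in }\Omega^\varepsilon,\qquad \mathbf u^\varepsilon=0\ \text{ on }\partial\Omega^\varepsilon\setminus\partial\Omega,$$ $$\operatorname{div}\Big(n_i^{0,\varepsilon}\Big(\sum_{j=1}^NK_{ij}^{0,\varepsilon}z_j\nabla(\Phi_j^\varepsilon+\Psi^{ext,*})+\mathrm{Pe}_i\,\mathbf u^\varepsilon\Big)\Big)=0\quad\text{in }\Omega^\varepsilon,\ i=1,\dots,N,$$ $$\sum_{j=1}^NK_{ij}^{0,\varepsilon}z_j\nabla(\Phi_j^\varepsilon+\Psi^{ext,*})\cdot\nu=0\quad\text{on }\partial\Omega^\varepsilon\setminus\partial\Omega,\ i=1,\dots,N,$$ $$\mathbf u^\varepsilon,\ P^\varepsilon,\ \Phi_j^\varepsilon\ \text{ are }\Omega\text{-periodic},$$ where the coefficients $n_j^{0,\varepsilon}$ and $K_{ij}^{0,\varepsilon}$ are evaluated at equilibrium and $$P^\varepsilon=\delta p^\varepsilon+\sum_{j=1}^Nz_jn_j^{0,\varepsilon}\big(\delta\Psi^\varepsilon+\Phi_j^\varepsilon+\Psi^{ext,*}\big).$$ That is, the first-order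 variations (in the size of the external forces) of any smooth family of solutions through the equilibrium solution satisfy this system.
   Context: Setting: $\Omega=\prod_{k=1}^d(0,L_k)$ with periodic boundary conditions, $\Omega^\varepsilon\subset\Omega$ the (smooth) fluid domain, $\partial\Omega^\varepsilon\setminus\partial\Omega$ the solid boundary with unit normal $\nu$. Nonzero integer valencies $z_1<\dots<z_N$, $z_1<0<z_N$; positive parameters $\varepsilon,\beta,N_\sigma,\mathrm{Pe}_i,L_B,\Gamma_c,\sigma_c,\sigma_j,\xi_c,n_c,D_i^0,k_BT,\eta,\mathcal E,e$ with $L_B=e^2/(4\pi\mathcal Ek_BT)$, $\Gamma_c=\sqrt{\pi L_Bn_c}$, $\xi_c=\frac{\pi}{6}n_c\sigma_c^3$ and $L_B<(6+4\sqrt2)\min_j\sigma_j/z_j^2$. Surface charge $\Sigma^*$; external force $\mathbf f^*$ and external potential $\Psi^{ext,*}$. Electrokinetic equations (unknowns $\mathbf u^\varepsilon,p^\varepsilon,\Psi^\varepsilon,n_j^\varepsilon>0$), in $\Omega^\varepsilon$: $$\varepsilon^2\Delta\mathbf u^\varepsilon-\nabla p^\varepsilon=\mathbf f^*+\sum_jz_jn_j^\varepsilon\nabla\Psi^\varepsilon,\quad \operatorname{div}\mathbf u^\varepsilon=0,\quad -\varepsilon^2\Delta\Psi^\varepsilon=\beta\sum_jz_jn_j^\varepsilon,\quad \operatorname{div}(\mathbf j_i^\varepsilon+\mathrm{Pe}_in_i^\varepsilon\mathbf u^\varepsilon)=0,$$ $$\mathbf j_i^\varepsilon=-\sum_jn_i^\varepsilon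 K_{ij}^\varepsilon\nabla M_j^\varepsilon,\qquad M_j^\varepsilon=\ln(n_j^\varepsilon\gamma_j^\varepsilon e^{z_j\Psi^\varepsilon}),$$ with $\mathbf u^\varepsilon=0$, $\varepsilon\nabla\Psi^\varepsilon\cdot\nu=-N_\sigma\Sigma^*$, $\mathbf j_i^\varepsilon\cdot\nu=0$ on the solid boundary, and $\Psi^\varepsilon+\Psi^{ext,*}$, $n_i^\varepsilon$, $\mathbf u^\varepsilon$, $p^\varepsilon$ $\Omega$-periodic. Here $$\gamma_j^\varepsilon=\exp\Big\{p(\xi)-\frac{L_B\Gamma^\varepsilon\Gamma_cz_j^2}{1+\Gamma^\varepsilon\Gamma_c\sigma_j}\Big\},\quad (\Gamma^\varepsilon)^2=\sum_k\frac{n_k^\varepsilon z_k^2}{(1+\Gamma_c\Gamma^\varepsilon\sigma_k)^2},\ \Gamma^\varepsilon>0,\quad p(\xi)=\xi\frac{8-9\xi+3\xi^2}{(1-\xi)^3},\quad \xi=\xi_c\sum_kn_k^\varepsilon\Big(\frac{\sigma_k}{\sigma_c}\Big)^3\in[0,1).$$ $K^\varepsilon_{ij}=\big(\delta_{ij}+\frac{k_BT}{D_i^0}\Omega_{ij}\big)(1+\mathcal R_{ij})$ is the following function of the concentrations: with $c_j=n_cn_j^\varepsilon$ and $G=\Gamma_c\Gamma^\varepsilon$, $\Omega_{ij}=\Omega_{ij}^c+\Omega_{ij}^{HS}$, $$\Omega^c_{ij}=-\frac{1}{3\eta}\frac{z_iz_jL_Bc_j}{(1+G\sigma_i)(1+G\sigma_j)\big(G+\sum_kc_k\frac{\pi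 L_Bz_k^2\sigma_k}{(1+G\sigma_k)^2}\big)},\quad \Omega^{HS}_{ij}=-\frac{(\sigma_i+\sigma_j)^2}{12\eta}c_j\frac{1-\tilde X_3/5+\tilde X_3^2/10}{1+2\tilde X_3},$$ $$\tilde X_3=\frac{\pi}{6}\sum_ic_i\frac{3X_1X_2+X_3X_0}{4X_0^2},\quad X_k=\frac\pi6\sum_ic_i\sigma_i^k,\quad \kappa_q=\Big(\frac{e^2}{\mathcal Ek_BT}\frac{\sum_ic_iz_i^2D_i^0}{\sum_iD_i^0}\Big)^{1/2},$$ $$\mathcal R_{ij}=\frac{\kappa_q^2e^2z_iz_j}{3\mathcal Ek_BT(\sigma_i+\sigma_j)(1+G\sigma_i)(1+G\sigma_j)}\,\frac{1-e^{-2\kappa_q(\sigma_i+\sigma_j)}}{\kappa_q^2+2G\kappa_q+2G^2-2\pi L_B\sum_kc_k\frac{z_k^2e^{-\kappa_q\sigma_k}}{(1+G\sigma_k)^2}}.$$ Equilibrium solution: a solution $(\mathbf u^{0,\varepsilon}=0,p^{0,\varepsilon},\Psi^{0,\varepsilon},n_j^{0,\varepsilon})$ for $\mathbf f^*=0$, $\Psi^{ext,*}=0$, with $\nabla M_j^{0,\varepsilon}=0$; thus $n_j^{0,\varepsilon}\gamma_j^{0,\varepsilon}=n_j^0(\infty)\gamma_j^0(\infty)e^{-z_j\Psi^{0,\varepsilon}}$ with positive constants $n_j^0(\infty),\gamma_j^0(\infty)$. A superscript $0,\varepsilon$ means evaluation at equilibrium. Ionic potentials $\Phi_i^\varepsilon$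 are defined by $n_i^\varepsilon\gamma_i^\varepsilon=n_i^0(\infty)\gamma_i^0(\infty)\exp\{-z_i(\Psi^\varepsilon+\Phi_i^\varepsilon+\Psi^{ext,*})\}$, so $\Phi_i^{0,\varepsilon}=0$. Linearization means: replace $(\mathbf f^*,\Psi^{ext,*})$ by $(t\mathbf f^*,t\Psi^{ext,*})$, consider a family of solutions smooth in $t$ equal to the equilibrium one at $t=0$, and differentiate at $t=0$; the resulting derivatives of $\mathbf u^\varepsilon,p^\varepsilon,\Psi^\varepsilon,\Phi_i^\varepsilon$ are denoted $\mathbf u^\varepsilon,\delta p^\varepsilon,\delta\Psi^\varepsilon,\Phi_i^\varepsilon$. *)

(* Defs.v *)
From HB Require Import structures.
From mathcomp Require Import all_boot all_order all_algebra.
From mathcomp Require Import all_classical all_reals all_analysis.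

Set Implicit Arguments.
Unset Strict Implicit.
Unset Printing Implicit Defensive.

Import Order.TTheory GRing.Theory Num.Theory.
Import numFieldNormedType.Exports.

Local Open Scope classical_set_scope.
Local Open Scope ring_scope.

(* Points and vectors of R^d are row vectors; [`|x|] is the
   sup norm there, so Euclidean lengths go through [dot]. *)

Definition dot (R : realType) (d : nat) (a b : 'rV[R]_d) : R :=
  \sum_(k < d) a 0 k * b 0 k.

Definition partial (R : realType) (d : nat) (k : 'I_d) (f : 'rV[R]_d -> R) :
    'rV[R]_d -> R :=
  'D_(delta_mx 0 k : 'rV[R]_d) f.

Definition grad (R : realType) (d : nat) (f : 'rV[R]_d -> R) (x : 'rV[R]_d) :
    'rV[R]_d :=
  \row_k partial k f x.

Definition div (R : realType) (d : nat) (w : 'rV[R]_d -> 'rV[R]_d)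
    (x : 'rV[R]_d) : R :=
  \sum_(k < d) partial k (fun y => w y 0 k) x.

Definition lap (R : realType) (d : nat) (f : 'rV[R]_d -> R) (x : 'rV[R]_d) : R :=
  \sum_(k < d) partial k (partial k f) x.

Definition vlap (R : realType) (d : nat) (w : 'rV[R]_d -> 'rV[R]_d)
    (x : 'rV[R]_d) : 'rV[R]_d :=
  \row_k lap (fun y => w y 0 k) x.

(* [Ck k U f], for U open: f is of class C^k on U. *)
Fixpoint Ck (R : realType) (V W : normedModType R) (k : nat) (U : set V)
    (f : V -> W) : Prop :=
  match k with
  | 0 => forall x, U x -> {for x, continuous f}
  | k'.+1 => (forall x, U x -> differentiable f x) /\
             (forall v, Ck k' U ('D_v f))
  end.

Definition Ck_near (R : realType) (V W : normedModType R) (k : nat) (F : set V)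
    (f : V -> W) : Prop :=
  exists U : set V, [/\ open U, F `<=` U & Ck k U f].

Record geometry (R : realType) (d : nat) := Geometry {
  len : 'I_d -> R;                    (* L_k *)
  fluid : set 'rV[R]_d;               (* Omega^eps *)
  normal : 'rV[R]_d -> 'rV[R]_d       (* nu, used on the solid boundary only *)
}.

Definition box (R : realType) (d : nat) (D : geometry R d) : set 'rV[R]_d :=
  [set x | forall k, 0 < x 0 k < len D k].

Definition boundary (T : topologicalType) (A : set T) : set T :=
  closure A `\` interior A.

Definition solid_boundary (R : realType) (d : nat) (D : geometry R d) :
    set 'rV[R]_d :=
  boundary (fluid D) `\` boundary (box D).

(* The union of all lattice translates of the closed fluid domain.  Periodic
   fields are functions on R^d of which only the values on (a neighbourhood of)
   this set matter; what they do elsewhere, inside the solid, is irrelevant. *)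
Definition fluid_region (R : realType) (d : nat) (D : geometry R d) :
    set 'rV[R]_d :=
  [set x | exists m : 'I_d -> int,
             closure (fluid D) (x + \row_k ((m k)%:~R * len D k))].

Definition box_periodic (R : realType) (d : nat) (T : Type) (D : geometry R d)
    (f : 'rV[R]_d -> T) : Prop :=
  forall x k, fluid_region D x ->
    f (x + len D k *: (delta_mx 0 k : 'rV[R]_d)) = f x.

(* The boundary is locally the zero level of a smooth function [rho], negative
   in the fluid, to whose gradient the unit vector [normal D x] is parallel;
   the orientation of the normal is left free. *)
Record wf_geometry (R : realType) (d : nat) (D : geometry R d) : Prop := {
  len_gt0 : forall k, 0 < len D k;
  fluid_open : open (fluid D);
  fluid_sub : fluid D `<=` box D;
  fluid_smooth : forall x, solid_boundary D x ->
    exists (V : set 'rV[R]_d) (rho : 'rV[R]_d -> R),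
      [/\ open V, V x, (forall k, Ck k V (rho : 'rV[R]_d -> R^o)),
          (forall y, V y -> fluid D y <-> rho y < 0) &
          [/\ rho x = 0, grad rho x != 0, dot (normal D x) (normal D x) = 1 &
              exists c : R, normal D x = c *: grad rho x]]
}.

Record params (R : realType) (N : nat) := Params {
  eps : R; beta : R; Nsigma : R;
  Pe : 'I_N -> R;
  valency : 'I_N -> int;              (* z_i *)
  LB : R; Gammac : R; sigmac : R;
  sigma : 'I_N -> R;
  xic : R; nc : R;
  D0 : 'I_N -> R;
  kBT : R; eta : R;
  calE : R;                           (* dielectric permittivity *)
  echarge : R                         (* elementary charge *)
}.

Definition zR (R : realType) (N : nat) (P : params R N) (i : 'I_N) : R :=
  (valency P i)%:~R.

(* The last bound is L_B < (6 + 4 sqrt 2) min_j sigma_j / z_j^2. *)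
Record wf_params (R : realType) (N : nat) (P : params R N) : Prop := {
  N_gt0 : (0 < N)%N;
  z_neq0 : forall i, valency P i != 0;
  z_incr : forall i j : 'I_N, (i < j)%N -> valency P i < valency P j;
  z_first : forall i : 'I_N, nat_of_ord i = 0%N -> valency P i < 0;
  z_last : forall i : 'I_N, i.+1 = N -> 0 < valency P i;
  eps_gt0 : 0 < eps P;
  beta_gt0 : 0 < beta P;
  Nsigma_gt0 : 0 < Nsigma P;
  Pe_gt0 : forall i, 0 < Pe P i;
  LB_gt0 : 0 < LB P;
  Gammac_gt0 : 0 < Gammac P;
  sigmac_gt0 : 0 < sigmac P;
  sigma_gt0 : forall j, 0 < sigma P j;
  xic_gt0 : 0 < xic P;
  nc_gt0 : 0 < nc P;
  D0_gt0 : forall i, 0 < D0 P i;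
  kBT_gt0 : 0 < kBT P;
  eta_gt0 : 0 < eta P;
  calE_gt0 : 0 < calE P;
  echarge_gt0 : 0 < echarge P;
  LB_def : LB P = echarge P ^+ 2 / (4 * pi * calE P * kBT P);
  Gammac_def : Gammac P = Num.sqrt (pi * LB P * nc P);
  xic_def : xic P = pi / 6 * nc P * sigmac P ^+ 3;
  LB_bound : forall j,
    LB P < (6 + 4 * Num.sqrt 2) * (sigma P j / zR P j ^+ 2)
}.

(* Below, [n] is the vector of the concentrations
   at a point. *)

(* The equation has exactly one positive solution when all n_k > 0: its left
   side increases and its right side is nonincreasing in g > 0. *)
Definition Gam (R : realType) (N : nat) (P : params R N) (n : 'I_N -> R) : R :=
  xget 0 [set g : R | 0 < g /\
    g ^+ 2 = \sum_k n k * zR P k ^+ 2 / (1 + Gammac P * g * sigma P k) ^+ 2].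

Definition xi (R : realType) (N : nat) (P : params R N) (n : 'I_N -> R) : R :=
  xic P * \sum_k n k * (sigma P k / sigmac P) ^+ 3.

Definition pHS (R : realType) (s : R) : R :=
  s * ((8 - 9 * s + 3 * s ^+ 2) / (1 - s) ^+ 3).

Definition act_coef (R : realType) (N : nat) (P : params R N) (n : 'I_N -> R)
    (j : 'I_N) : R :=
  let g := Gam P n in
  expR (pHS (xi P n)
        - LB P * g * Gammac P * zR P j ^+ 2 / (1 + g * Gammac P * sigma P j)).

Definition cdim (R : realType) (N : nat) (P : params R N) (n : 'I_N -> R)
    (j : 'I_N) : R := nc P * n j.

Definition Gdim (R : realType) (N : nat) (P : params R N) (n : 'I_N -> R) : R :=
  Gammac P * Gam P n.

Definition Omega_c (R : realType) (N : nat) (P : params R N) (n : 'I_N -> R)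
    (i j : 'I_N) : R :=
  let c := cdim P n in let G := Gdim P n in
  - (1 / (3 * eta P)) *
  (zR P i * zR P j * LB P * c j /
   ((1 + G * sigma P i) * (1 + G * sigma P j) *
    (G + \sum_k c k * (pi * LB P * zR P k ^+ 2 * sigma P k
                       / (1 + G * sigma P k) ^+ 2)))).

Definition Xmom (R : realType) (N : nat) (P : params R N) (n : 'I_N -> R)
    (k : nat) : R :=
  pi / 6 * \sum_i cdim P n i * sigma P i ^+ k.

Definition X3tilde (R : realType) (N : nat) (P : params R N) (n : 'I_N -> R) : R :=
  let X := Xmom P n in
  pi / 6 * \sum_i cdim P n i *
             ((3 * X 1%N * X 2%N + X 3%N * X 0%N) / (4 * X 0%N ^+ 2)).

Definition Omega_HS (R : realType) (N : nat) (P : params R N) (n : 'I_N -> R)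
    (i j : 'I_N) : R :=
  let X3 := X3tilde P n in
  - ((sigma P i + sigma P j) ^+ 2 / (12 * eta P)) * cdim P n j *
  ((1 - X3 / 5 + X3 ^+ 2 / 10) / (1 + 2 * X3)).

Definition kappaq (R : realType) (N : nat) (P : params R N) (n : 'I_N -> R) : R :=
  Num.sqrt (echarge P ^+ 2 / (calE P * kBT P) *
            ((\sum_i cdim P n i * zR P i ^+ 2 * D0 P i) / \sum_i D0 P i)).

Definition Rrel (R : realType) (N : nat) (P : params R N) (n : 'I_N -> R)
    (i j : 'I_N) : R :=
  let c := cdim P n in let G := Gdim P n in let kq := kappaq P n in
  kq ^+ 2 * echarge P ^+ 2 * zR P i * zR P j
    / (3 * calE P * kBT P * (sigma P i + sigma P j)
       * (1 + G * sigma P i) * (1 + G * sigma P j)) *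
  ((1 - expR (- (2 * kq * (sigma P i + sigma P j))))
    / (kq ^+ 2 + 2 * G * kq + 2 * G ^+ 2
       - 2 * pi * LB P *
         \sum_k c k * (zR P k ^+ 2 * expR (- (kq * sigma P k))
                       / (1 + G * sigma P k) ^+ 2))).

Definition Kmat (R : realType) (N : nat) (P : params R N) (n : 'I_N -> R)
    (i j : 'I_N) : R :=
  ((i == j)%:R + kBT P / D0 P i * (Omega_c P n i j + Omega_HS P n i j))
  * (1 + Rrel P n i j).

Record state (R : realType) (N d : nat) := State {
  vel : 'rV[R]_d -> 'rV[R]_d;
  pres : 'rV[R]_d -> R;
  pot : 'rV[R]_d -> R;
  conc : 'I_N -> 'rV[R]_d -> R
}.

Definition conc_at (R : realType) (N d : nat) (S : state R N d) (x : 'rV[R]_d) :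
    'I_N -> R := fun k => conc S k x.

Definition Mpot (R : realType) (N d : nat) (P : params R N) (S : state R N d)
    (j : 'I_N) (x : 'rV[R]_d) : R :=
  ln (conc S j x * act_coef P (conc_at S x) j * expR (zR P j * pot S x)).

Definition flux (R : realType) (N d : nat) (P : params R N) (S : state R N d)
    (i : 'I_N) (x : 'rV[R]_d) : 'rV[R]_d :=
  - \sum_j (conc S i x * Kmat P (conc_at S x) i j) *: grad (Mpot P S j) x.

(* Classical solutions.  The logarithm of the concentrations is differentiated
   up to the boundary, whence positivity on the closed region. *)
Record ek_solution (R : realType) (N d : nat) (P : params R N)
    (D : geometry R d) (f : 'rV[R]_d -> 'rV[R]_d)
    (Sigma Psiext : 'rV[R]_d -> R) (S : state R N d) : Prop := {
  ek_vel_reg : Ck_near 2 (fluid_region D) (vel S);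
  ek_pres_reg : Ck_near 1 (fluid_region D) (pres S : 'rV[R]_d -> R^o);
  ek_pot_reg : Ck_near 2 (fluid_region D) (pot S : 'rV[R]_d -> R^o);
  ek_conc_reg : forall i,
    Ck_near 2 (fluid_region D) (conc S i : 'rV[R]_d -> R^o);
  ek_conc_gt0 : forall i x, fluid_region D x -> 0 < conc S i x;
  ek_xi : forall x, fluid_region D x -> 0 <= xi P (conc_at S x) < 1;
  ek_momentum : forall x, fluid D x ->
    eps P ^+ 2 *: vlap (vel S) x - grad (pres S) x =
    f x + \sum_j (zR P j * conc S j x) *: grad (pot S) x;
  ek_incompressible : forall x, fluid D x -> div (vel S) x = 0;
  ek_poisson : forall x, fluid D x ->
    - (eps P ^+ 2 * lap (pot S) x) = beta P * \sum_j zR P j * conc S j x;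
  ek_transport : forall i x, fluid D x ->
    div (fun y => flux P S i y + (Pe P i * conc S i y) *: vel S y) x = 0;
  ek_noslip : forall x, solid_boundary D x -> vel S x = 0;
  ek_surface_charge : forall x, solid_boundary D x ->
    eps P * dot (grad (pot S) x) (normal D x) = - (Nsigma P * Sigma x);
  ek_noflux : forall i x, solid_boundary D x ->
    dot (flux P S i x) (normal D x) = 0;
  ek_pot_per : box_periodic D (fun x => pot S x + Psiext x);
  ek_conc_per : forall i, box_periodic D (conc S i);
  ek_vel_per : box_periodic D (vel S);
  ek_pres_per : box_periodic D (pres S)
}.

(* [ninf] and [ginf] are the constants n_j^0(oo) and gamma_j^0(oo). *)
Record equilibrium (R : realType) (N d : nat) (P : params R N)
    (D : geometry R d) (Sigma : 'rV[R]_d -> R) (ninf ginf : 'I_N -> R)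
    (S : state R N d) : Prop := {
  eq_solution : ek_solution P D (fun=> 0) Sigma (fun=> 0) S;
  eq_vel : forall x, fluid_region D x -> vel S x = 0;
  eq_Mpot : forall j x, fluid D x -> grad (Mpot P S j) x = 0;
  eq_ninf_gt0 : forall j, 0 < ninf j;
  eq_ginf_gt0 : forall j, 0 < ginf j;
  eq_boltzmann : forall j x, fluid D x ->
    conc S j x * act_coef P (conc_at S x) j =
    ninf j * ginf j * expR (- (zR P j * pot S x))
}.

(* The defining relation of the ionic potentials is imposed wherever it makes
   sense, which includes a neighbourhood of the closed fluid region. *)
Definition ionic_potential (R : realType) (N d : nat) (P : params R N)
    (ninf ginf : 'I_N -> R) (Psiext : 'rV[R]_d -> R) (S : state R N d)
    (Phi : 'I_N -> 'rV[R]_d -> R) : Prop :=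
  forall i x, (forall j, 0 < conc S j x) ->
    conc S i x * act_coef P (conc_at S x) i =
    ninf i * ginf i * expR (- (zR P i * (pot S x + Phi i x + Psiext x))).

(* Joint regularity in (t, x) near {0} x (closed fluid region): one derivative
   in t on top of the space derivatives occurring in the equations. *)
Record smooth_family (R : realType) (N d : nat) (D : geometry R d)
    (S : R -> state R N d) : Prop := {
  fam_vel : Ck_near 3 ([set 0] `*` fluid_region D)
    (fun tx : R^o * 'rV[R]_d => vel (S tx.1) tx.2);
  fam_pres : Ck_near 2 ([set 0] `*` fluid_region D)
    ((fun tx => pres (S tx.1) tx.2) : R^o * 'rV[R]_d -> R^o);
  fam_pot : Ck_near 3 ([set 0] `*` fluid_region D)
    ((fun tx => pot (S tx.1) tx.2) : R^o * 'rV[R]_d -> R^o);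
  fam_conc : forall i, Ck_near 3 ([set 0] `*` fluid_region D)
    ((fun tx => conc (S tx.1) i tx.2) : R^o * 'rV[R]_d -> R^o)
}.

Definition first_variation (R : realType) (d : nat) (V : normedModType R)
    (f : R -> 'rV[R]_d -> V) (x : 'rV[R]_d) : V :=
  derive1 (fun t => f t x) 0.

(* Only the sums Phi_j + Psiext are differentiated, so no regularity is asked
   of Psiext alone. *)
Record linearized_solution (R : realType) (N d : nat) (P : params R N)
    (D : geometry R d) (f : 'rV[R]_d -> 'rV[R]_d) (Psiext : 'rV[R]_d -> R)
    (n0 : 'I_N -> 'rV[R]_d -> R) (u : 'rV[R]_d -> 'rV[R]_d)
    (p : 'rV[R]_d -> R) (Phi : 'I_N -> 'rV[R]_d -> R) : Prop := {
  lin_vel_reg : Ck_near 2 (fluid_region D) u;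
  lin_pres_reg : Ck_near 1 (fluid_region D) (p : 'rV[R]_d -> R^o);
  lin_Phi_reg : forall j, Ck_near 2 (fluid_region D)
    ((fun y => Phi j y + Psiext y) : 'rV[R]_d -> R^o);
  lin_momentum : forall x, fluid D x ->
    eps P ^+ 2 *: vlap u x - grad p x =
    f x - \sum_j (zR P j * n0 j x) *: grad (fun y => Phi j y + Psiext y) x;
  lin_incompressible : forall x, fluid D x -> div u x = 0;
  lin_noslip : forall x, solid_boundary D x -> u x = 0;
  lin_transport : forall i x, fluid D x ->
    div (fun y => n0 i y *:
           (\sum_j (Kmat P (fun k => n0 k y) i j * zR P j)
                     *: grad (fun y' => Phi j y' + Psiext y') y
            + Pe P i *: u y)) x = 0;
  lin_noflux : forall i x, solid_boundary D x ->
    dot (\sum_j (Kmat P (fun k => n0 k x) i j * zR P j)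
                  *: grad (fun y => Phi j y + Psiext y) x) (normal D x) = 0;
  lin_vel_per : box_periodic D u;
  lin_pres_per : box_periodic D p;
  lin_Phi_per : forall j, box_periodic D (Phi j)
}.

(* Main.v *)
Require Import Defs.
From mathcomp Require Import all_boot all_order all_algebra.
From mathcomp Require Import all_classical all_reals all_analysis.
From mathcomp Require Import ring.
Import Order.TTheory GRing.Theory Num.Theory.
Import numFieldNormedType.Exports.
Local Open Scope classical_set_scope.
Local Open Scope ring_scope.

Set Implicit Arguments.
Unset Strict Implicit.
Unset Printing Implicit Defensive.

(** Every equation of the linearized system is the [t]-derivative at [t = 0] of
    an equation satisfied by the family, so the fields are studied as functions
    of the pair [(t, x)], where [d/dt] and the space derivatives commute
    ([Schwarz]). Three facts make the differentiated equations take the stated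
    form.

    1. The electrochemical potential is
       [M_j = ln (n_j gamma_j) + z_j Psi
            = ln (ninf_j ginf_j) - z_j (Phi_j + t Psiext)],
       so the variation of [Phi_j + Psiext] is [- z_j^-1 (dM_j/dt)]. As the
       space gradient of [M_j] vanishes at equilibrium, the product rule applied
       to the flux [- sum_j n_i K_ij grad M_j] leaves only the term where
       [grad M_j] is varied. Hence the transport equations and the no-flux
       conditions; all that is asked of [K_ij] is smoothness ([Ck_Kmat]).

    2. For a common diameter [sigma] the equation for [Gamma] is
       [Gamma (1 + Gammac sigma Gamma) = sqrt I], with [I = sum_k n_k z_k^2] the
       ionic strength. It is solved by an explicit smooth function of [I]
       ([GamE]), and
       [ln (n_j gamma_j) = ln n_j + A(sum_k n_k) + z_j^2 B(I)]
       ([log_activityE]). The denominators of [K_ij] are positive; for the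
       relaxation term this is again the equation for [Gamma]
       ([Rrel_den_gt0]).

    3. By this formula the Jacobian of [n -> (ln (n_j gamma_j))_j] is symmetric
       ([log_activity_symmetry]). The variation of the electric force contains
       [sum_j z_j (dn_j/dt) grad Psi], which is
       [- sum_j (dn_j/dt) grad ln (n_j gamma_j)] at equilibrium; the symmetry
       turns it into [- sum_j grad n_j (d/dt) ln (n_j gamma_j)], that is, into
       [sum_j z_j grad n_j (dPsi + dPhi_j + Psiext)], and this is exactly what
       the gradient of the modified pressure absorbs. *)

(** * Functions of class C^k *)

Lemma open_in_near (T : topologicalType) (U : set T) (x : T) (P : T -> Prop) :
  open U -> U x -> (forall y, U y -> P y) -> \forall y \near x, P y.
Proof.
by move=> Uo Ux UP; apply: filterS UP _; exact: open_nbhs_nbhs.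
Qed.

Section ClassCk.
Context {R : realType} {V W : normedModType R}.
Implicit Types (U : set V) (k : nat).

Lemma derive_ext U (f g : V -> W) v x : open U -> U x ->
  (forall y, U y -> f y = g y) -> 'D_v f x = 'D_v g x.
Proof.
by move=> Uo Ux fg; apply: near_eq_derive; exact: (open_in_near Uo Ux).
Qed.

(** The differential and the remainder of [f] serve for [g] as well. *)
Lemma near_differentiable (f g : V -> W) (x : V) :
  (\forall y \near x, f y = g y) -> differentiable f x -> differentiable g x.
Proof.
move=> fg df; have [dfc dfE] := (diff_locallyP x f).1 df.
have gE : g \o shift x = cst (g x) + 'd f x +o_ 0 id.
  apply/eqaddoP => _ /posnumP[e].
  move/eqaddoP: dfE => /(_ _ [gt0 of e%:num]).
  have fgx : f x = g x by exact: nbhs_singleton fg.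
  have fg0 : \forall y \near (0 : V), f (y + x) = g (y + x).
    by move: fg; rewrite (near_shift 0) /=; apply: filterS => y /=; rewrite subr0.
  apply: filterS2 fg0 => y /= fgy; rewrite !fctE /= fgx fgy; exact.
by apply/diff_locallyP; rewrite (diff_unique dfc gE).
Qed.

Lemma differentiable_ext U (f g : V -> W) x : open U -> U x ->
  (forall y, U y -> f y = g y) -> differentiable f x -> differentiable g x.
Proof.
by move=> Uo Ux fg; apply: near_differentiable; exact: (open_in_near Uo Ux).
Qed.

Lemma Ck_ext k U (f g : V -> W) : open U ->
  (forall y, U y -> f y = g y) -> Ck k U f -> Ck k U g.
Proof.
move=> Uo; elim: k f g => [|k IH] f g fg /=.
  move=> fc x Ux; rewrite /prop_for /= /continuous_at -(fg x Ux).
  apply: cvg_trans (fc x Ux); apply: near_eq_cvg.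
  exact: (open_in_near Uo Ux).
move=> [fd fD]; split=> [x Ux|v].
  exact: differentiable_ext (fg) (fd x Ux).
by apply: IH (fD v) => y Uy; exact: derive_ext fg.
Qed.

Lemma Ck_subset k U U' (f : V -> W) : U' `<=` U -> Ck k U f -> Ck k U' f.
Proof.
move=> sUU'; elim: k f => [|k IH] f /=; first by move=> fc x /sUU' /fc.
by move=> [fd fD]; split=> [x /sUU' /fd //|v]; apply: IH.
Qed.

Lemma Ck_weak k U (f : V -> W) : Ck k.+1 U f -> Ck k U f.
Proof.
elim: k f => [|k IH] f [fd fD].
  by move=> x Ux; apply: differentiable_continuous; exact: fd.
by split=> // v; apply: IH.
Qed.

Lemma Ck_le k l U (f : V -> W) : (l <= k)%N -> Ck k U f -> Ck l U f.
Proof.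
move=> /subnK <-; elim: (k - l)%N => [|m IH] //.
by rewrite addSn => /Ck_weak /IH.
Qed.

Lemma Ck_diff k U (f : V -> W) x : Ck k.+1 U f -> U x -> differentiable f x.
Proof. by move=> [fd _]; exact: fd. Qed.

Lemma Ck_derive k U (f : V -> W) v : Ck k.+1 U f -> Ck k U ('D_v f).
Proof. by move=> [_ fD]; exact: fD. Qed.

Lemma Ck_cst k U (c : W) : Ck k U (fun=> c : W).
Proof.
elim: k c => [|k IH] c /=; first by move=> x _; exact: cst_continuous.
split=> [x _|v]; first exact: differentiable_cst.
by rewrite (_ : 'D_v _ = fun=> 0)//; apply/funext => x; exact: derive_cst.
Qed.

Lemma Ck_add k U (f g : V -> W) : open U ->
  Ck k U f -> Ck k U g -> Ck k U (fun x => f x + g x).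
Proof.
move=> Uo; elim: k f g => [|k IH] f g /=.
  by move=> fc gc x Ux; exact: (@continuousD _ _ _ f g x (fc x Ux) (gc x Ux)).
move=> [fd fD] [gd gD]; split=> [x Ux|v].
  by apply: (@differentiableD _ _ _ f g); [exact: fd|exact: gd].
apply: (Ck_ext Uo) (IH _ _ (fD v) (gD v)) => y Uy.
by rewrite -deriveD//; apply: diff_derivable; [exact: fd|exact: gd].
Qed.

Lemma Ck_opp k U (f : V -> W) : open U -> Ck k U f -> Ck k U (fun x => - f x).
Proof.
move=> Uo; elim: k f => [|k IH] f /=.
  by move=> fc x Ux; exact: (@continuousN _ _ _ f x (fc x Ux)).
move=> [fd fD]; split=> [x Ux|v].
  by apply: (@differentiableN _ _ _ f); exact: fd.
apply: (Ck_ext Uo) (IH _ (fD v)) => y Uy.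
by rewrite -deriveN//; apply: diff_derivable; exact: fd.
Qed.

End ClassCk.

Section ClassCkReal.
Context {R : realType} {V : normedModType R}.
Implicit Types (U : set V) (k : nat).

Lemma Ck_mul k U (f g : V -> R^o) : open U ->
  Ck k U f -> Ck k U g -> Ck k U ((fun x => f x * g x) : V -> R^o).
Proof.
move=> Uo; elim: k f g => [|k IH] f g.
  by move=> fc gc x Ux; exact: (@continuousM _ _ f g x (fc x Ux) (gc x Ux)).
move=> fk gk; have [fd fD] := fk; have [gd gD] := gk; split=> [x Ux|v].
  by apply: (@differentiableM _ _ f g); [exact: fd|exact: gd].
apply: (Ck_ext Uo) (Ck_add Uo (IH _ _ (Ck_weak fk) (gD v))
                              (IH _ _ (Ck_weak gk) (fD v))) => y Uy.
by rewrite -deriveM//; apply: diff_derivable; [exact: fd|exact: gd].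
Qed.

Lemma Ck_sum k U (I : Type) (r : seq I) (f : I -> V -> R^o) : open U ->
  (forall i, Ck k U (f i)) ->
  Ck k U ((fun x => \sum_(i <- r) f i x) : V -> R^o).
Proof.
move=> Uo fk; elim: r => [|i r IH].
  by apply: (Ck_ext Uo) (Ck_cst _ _ (0 : R^o)) => y _; rewrite big_nil.
by apply: (Ck_ext Uo) (Ck_add Uo (fk i) IH) => y _; rewrite big_cons.
Qed.

Lemma derive_comp1 (phi : R^o -> R^o) (f : V -> R^o) (x v : V) :
  differentiable f x -> differentiable phi (f x) ->
  'D_v (phi \o f) x = 'D_1 phi (f x) * 'D_v f x.
Proof.
move=> df dphi; rewrite !deriveE//; last exact: differentiable_comp.
rewrite diff_comp//= -[X in 'd phi _ X]mulr1.
by rewrite [LHS]linearZ mulrC.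
Qed.

Lemma Ck_comp k U (J : set R^o) (phi : R^o -> R^o) (f : V -> R^o) :
  open U -> (forall x, U x -> J (f x)) ->
  Ck k J phi -> Ck k U f -> Ck k U (phi \o f).
Proof.
move=> Uo fJ; elim: k phi f fJ => [|k IH] phi f fJ.
  by move=> pc fc x Ux; apply: continuous_comp; [exact: fc|exact/pc/fJ].
move=> [pd pD] fk; have [fd fD] := fk; split=> [x Ux|v].
  by apply: differentiable_comp; [exact: fd|exact/pd/fJ].
apply: (Ck_ext Uo) (Ck_mul Uo (IH _ _ fJ (pD 1) (Ck_weak fk)) (fD v)) => y Uy.
by rewrite -derive_comp1//; [exact: fd|exact/pd/fJ].
Qed.

Lemma Ck_pow k (U : set V) (f : V -> R^o) m : open U -> Ck k U f ->
  Ck k U ((fun x => f x ^+ m) : V -> R^o).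
Proof.
move=> Uo fk; elim: m => [|m IH].
  by apply: (Ck_ext Uo) (Ck_cst k _ (1 : R^o)) => x _; rewrite expr0.
by apply: (Ck_ext Uo) (Ck_mul Uo fk IH) => x _; rewrite exprS.
Qed.

End ClassCkReal.

Section ElementaryFunctions.
Context {R : realType}.
Implicit Types k : nat.

Lemma Ck_id k (J : set R^o) : Ck k J (id : R^o -> R^o).
Proof.
case: k => [|k]; first by move=> x _; exact: cvg_id.
split=> [x _|v]; first exact: (@ex_diff _ _ _ _ _ _ _ (is_diff_id x)).
by rewrite (_ : 'D_v _ = fun=> v)//; [exact: Ck_cst|apply/funext => x; exact: derive_id].
Qed.

Let derive_R (phi : R^o -> R^o) (x v : R^o) : derivable phi x 1 ->
  'D_v phi x = v * 'D_1 phi x.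
Proof.
move=> /derivable1_diffP dphi; rewrite !deriveE//.
by rewrite -[in LHS](mulr1 v) [LHS]linearZ.
Qed.

Lemma Ck_invR k : Ck k [set x : R^o | x != 0] (GRing.inv : R^o -> R^o).
Proof.
have Jo : open [set x : R^o | x != 0] by exact: open_neq.
elim: k => [|k IH]; first by move=> x x0; exact: inv_continuous.
split=> [x x0|v]; first exact: differentiable_Rinv.
apply: (Ck_ext Jo) (Ck_opp Jo (Ck_mul Jo (Ck_cst k _ v) (Ck_mul Jo IH IH))).
move=> x x0; have dx := @derivable_id _ R^o x 1.
rewrite derive_R; last exact: (@derivableV _ _ id).
by rewrite (@deriveV _ _ id)// derive_id scaleNr mulrN -exprVn expr2 [_ *: _]mulr1.
Qed.

Lemma Ck_expR k (J : set R^o) : Ck k J (expR : R^o -> R^o).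
Proof.
suff H : Ck k setT (expR : R^o -> R^o) by exact: Ck_subset H.
elim: k => [|k IH]; first by move=> x _; exact: continuous_expR.
split=> [x _|v].
  by apply/derivable1_diffP; exact: derivable_expR.
apply: (Ck_ext openT) (Ck_mul openT (Ck_cst k _ v) IH) => x _.
by rewrite derive_R ?derive_val.
Qed.

Let pos_open : open [set x : R^o | 0 < x].
Proof. exact: open_gt. Qed.

Lemma Ck_lnR k : Ck k [set x : R^o | 0 < x] (@ln R : R^o -> R^o).
Proof.
have lnd (x : R) : 0 < x -> is_derive (x : R^o) 1 (@ln R : R^o -> R^o) x^-1.
  exact: is_derive1_ln.
case: k => [|k]; first by move=> x x0; exact: continuous_ln.
split=> [x x0|v].
  by apply/derivable1_diffP; have [] := lnd _ x0.
have ik : Ck k [set x : R^o | 0 < x] (GRing.inv : R^o -> R^o).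
  by apply: Ck_subset (Ck_invR k) => x /= x0; rewrite gt_eqF.
apply: (Ck_ext pos_open) (Ck_mul pos_open (Ck_cst k _ v) ik) => x x0.
by have [dx ex] := lnd _ x0; rewrite derive_R// ex.
Qed.

Lemma Ck_sqrtR k : Ck k [set x : R^o | 0 < x] (@Num.sqrt R : R^o -> R^o).
Proof.
have sd (x : R) : 0 < x ->
    is_derive (x : R^o) 1 (@Num.sqrt R : R^o -> R^o) (2 * Num.sqrt x)^-1.
  exact: is_derive1_sqrt.
elim: k => [|k IH]; first by move=> x _; exact: sqrt_continuous.
split=> [x x0|v].
  by apply/derivable1_diffP; have [] := sd _ x0.
have ik : Ck k [set x : R^o | 0 < x]
    ((GRing.inv : R^o -> R^o) \o (fun x => 2 * Num.sqrt x)).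
  apply: (Ck_comp pos_open) (Ck_invR k) _ => [x /= x0|].
    by rewrite mulf_neq0// gt_eqF ?sqrtr_gt0.
  exact: (Ck_mul pos_open (Ck_cst _ _ _)).
apply: (Ck_ext pos_open) (Ck_mul pos_open (Ck_cst k _ v) ik) => x x0.
by have [dx ex] := sd _ x0; rewrite derive_R// ex.
Qed.

Context {V : normedModType R}.
Implicit Types (U : set V).

Lemma Ck_inv k U (f : V -> R^o) : open U -> (forall x, U x -> f x != 0) ->
  Ck k U f -> Ck k U ((fun x => (f x)^-1) : V -> R^o).
Proof. by move=> Uo f0; exact: (Ck_comp Uo f0 (Ck_invR k)). Qed.

Lemma Ck_exp k U (f : V -> R^o) : open U ->
  Ck k U f -> Ck k U ((fun x => expR (f x)) : V -> R^o).
Proof. by move=> Uo; exact: (@Ck_comp _ _ _ _ setT _ _ Uo _ (Ck_expR k _)). Qed.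

Lemma Ck_ln k U (f : V -> R^o) : open U -> (forall x, U x -> 0 < f x) ->
  Ck k U f -> Ck k U ((fun x => ln (f x)) : V -> R^o).
Proof. by move=> Uo f0; exact: (Ck_comp Uo f0 (Ck_lnR k)). Qed.

Lemma Ck_sqrt k U (f : V -> R^o) : open U -> (forall x, U x -> 0 < f x) ->
  Ck k U f -> Ck k U ((fun x => Num.sqrt (f x)) : V -> R^o).
Proof. by move=> Uo f0; exact: (Ck_comp Uo f0 (Ck_sqrtR k)). Qed.

End ElementaryFunctions.

(** The directional derivative sees a function only through its increments
    along the direction. *)
Lemma eq_derive (R : realType) (V V' W : normedModType R)
    (f : V -> W) (g : V' -> W) (a v : V) (b w : V') :
  (forall h : R, f (h *: v + a) - f a = g (h *: w + b) - g b) ->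
  'D_v f a = 'D_w g b.
Proof.
move=> fg; rewrite /derive.
rewrite (_ : (fun h => _) = (fun h => h^-1 *: ((g \o shift b) (h *: w) - g b)))//.
by apply/funext => h /=; rewrite fg.
Qed.

Lemma eq_derivable (R : realType) (V V' W : normedModType R)
    (f : V -> W) (g : V' -> W) (a v : V) (b w : V') :
  (forall h : R, f (h *: v + a) - f a = g (h *: w + b) - g b) ->
  derivable f a v -> derivable g b w.
Proof.
move=> fg; rewrite /derivable.
rewrite (_ : (fun h => _) = (fun h => h^-1 *: ((g \o shift b) (h *: w) - g b)))//.
by apply/funext => h /=; rewrite fg.
Qed.

(** * Components and slices *)

Section Slices.
Context {R : realType} {d : nat}.
Notation X := 'rV[R]_d.
Notation TX := (R^o * X)%type.

Lemma Ck_coord (V : normedModType R) k (U : set V) (f : V -> X) j : open U ->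
  Ck k U f -> Ck k U ((fun x => f x 0 j) : V -> R^o).
Proof.
move=> Uo; elim: k f => [|k IH] f /=.
  move=> fc x Ux; apply: (@continuous_comp _ _ _ f (fun M : X => M 0 j : R^o)).
    exact: fc.
  exact: coord_continuous.
move=> [fd fD]; split=> [x Ux|v].
  by apply: (@differentiable_comp _ _ _ _ f (fun M : X => M 0 j : R^o));
    [exact: fd|exact: differentiable_coord].
apply: (Ck_ext Uo) (IH _ (fD v)) => x Ux.
by rewrite derive_mx ?mxE//; apply: diff_derivable; exact: fd.
Qed.

(** The difference quotients coincide, so that no regularity is involved. *)
Lemma derive_slice (W : normedModType R) (g : TX -> W) (t : R) (x v : X) :
  'D_v (fun y => g (t, y)) x = 'D_((0, v) : TX) g (t, x).
Proof.
apply: eq_derive => h; congr (g _ - _).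
by rewrite -[h *: _ + (t, x)]/(h *: (0 : R^o) + t, h *: v + x) scaler0 add0r.
Qed.

Lemma differentiable_slice (t : R) (x : X) :
  differentiable (fun y : X => (t, y) : TX) x.
Proof.
apply: differentiable_pair; first exact: differentiable_cst.
exact: (@ex_diff _ _ _ _ _ _ _ (is_diff_id x)).
Qed.

Lemma slice_continuous (t : R) (x : X) :
  {for x, continuous (fun y : X => (t, y) : TX)}.
Proof. exact/differentiable_continuous/differentiable_slice. Qed.

Lemma time_slice_continuous (t : R^o) (x : X) :
  {for t, continuous (fun s : R^o => (s, x) : TX)}.
Proof.
apply/differentiable_continuous/differentiable_pair.
  exact: (@ex_diff _ _ _ _ _ _ _ (is_diff_id t)).
exact: differentiable_cst.
Qed.

Lemma open_slice (U : set TX) (t : R) :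
  open U -> open [set y : X | U (t, y)].
Proof.
move=> Uo; apply: (@open_comp _ _ (fun y : X => (t, y) : TX)) Uo => y _.
exact: slice_continuous.
Qed.

Lemma Ck_slice (W : normedModType R) k (U : set TX) (g : TX -> W) (t : R) :
  Ck k U g -> Ck k [set y | U (t, y)] (fun y => g (t, y)).
Proof.
elim: k g => [|k IH] g /=.
  move=> gc y Uy; apply: (@continuous_comp _ _ _ (fun y : X => (t, y) : TX) g).
    exact: slice_continuous.
  exact: gc.
move=> [gd gD]; split=> [y Uy|v].
  apply: (@differentiable_comp _ _ _ _ (fun y : X => (t, y) : TX) g).
    exact: differentiable_slice.
  exact: gd.
rewrite (_ : 'D_v _ = fun y => 'D_((0, v) : TX) g (t, y)); first exact: IH (gD _).
by apply/funext => y; exact: derive_slice.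
Qed.

End Slices.

(** * Symmetry of second derivatives *)

Section Schwarz.
Context {R : realType} {V : normedModType R}.

Lemma is_derive_line (f : V -> R^o) (p u : V) (s : R) :
  derivable f (p + s *: u) u ->
  is_derive s 1 (fun r : R => f (p + r *: u) : R) ('D_u f (p + s *: u)).
Proof.
move=> df; have E h : f (h *: u + (p + s *: u)) - f (p + s *: u) =
    f (p + (h *: (1 : R^o) + s) *: u) - f (p + s *: u).
  by rewrite [h *: (1 : R^o)]mulr1 scalerDl addrCA.
by split; [exact: eq_derivable E df|exact/esym/eq_derive].
Qed.

Lemma MVT_line (f : V -> R^o) (p u : V) (h : R) : 0 <= h ->
  (forall s, 0 <= s <= h -> differentiable f (p + s *: u)) ->
  exists2 s, 0 <= s <= h & f (p + h *: u) - f p = h * 'D_u f (p + s *: u).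
Proof.
move=> h0 df.
have dl s : 0 <= s <= h ->
    is_derive s 1 (fun r : R => f (p + r *: u) : R) ('D_u f (p + s *: u)).
  by move=> /df sd; apply: is_derive_line; exact: diff_derivable.
have [s| |s] := MVT_segment (f := fun r : R => f (p + r *: u) : R)
    (df := fun s : R => 'D_u f (p + s *: u)) h0.
- by rewrite in_itv/= => /andP[s0 sh]; apply: dl; rewrite !ltW.
- apply: derivable_within_continuous => s; rewrite in_itv/= => /dl.
  by move=> [].
- rewrite in_itv/= scale0r addr0 subr0 => sh E; exists s => //.
  by rewrite mulrC.
Qed.

(** The second difference of [f] on the parallelogram spanned by [h u] and
    [h v] does not depend on the order of [u] and [v]; two applications of the
    mean value theorem turn it into a mixed second derivative at a nearby
    point. *)
Lemma second_difference (U : set V) (f : V -> R^o) (x u v : V) (h : R) :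
  0 <= h -> Ck 2 U f ->
  (forall s r, 0 <= s <= h -> 0 <= r <= h -> U (x + s *: u + r *: v)) ->
  exists s r, [/\ 0 <= s <= h, 0 <= r <= h &
    f (x + h *: u + h *: v) - f (x + h *: u) - (f (x + h *: v) - f x) =
    h * (h * 'D_v ('D_u f) (x + s *: u + r *: v))].
Proof.
move=> h0 [fd fD] Uh; have hh : 0 <= h <= h by rewrite h0 lexx.
have h00 : 0 <= (0 : R) <= h by rewrite lexx h0.
have df s r : 0 <= s <= h -> 0 <= r <= h -> differentiable f (x + s *: u + r *: v).
  by move=> sh rh; exact/fd/Uh.
pose g y := f (y + h *: v) - f y.
have dg0 s : 0 <= s <= h -> differentiable f (x + s *: u).
  by move=> sh; have := df _ _ sh h00; rewrite scale0r addr0.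
have dg1 s : 0 <= s <= h ->
    differentiable (fun y => f (y + h *: v) : R^o) (x + s *: u).
  move=> sh; apply: (@differentiable_comp _ _ _ _ (fun y => y + h *: v) f).
    apply: (@differentiableD _ _ _ id (cst (h *: v))).
      exact: (@ex_diff _ _ _ _ _ _ _ (is_diff_id _)).
    exact: differentiable_cst.
  exact: df.
have Dshift y : 'D_u (fun y => f (y + h *: v) : R^o) y = 'D_u f (y + h *: v).
  by apply: eq_derive => k; rewrite -addrA.
have [|s sh Es] := @MVT_line g x u h h0.
  by move=> s sh; apply: differentiableB; [exact: dg1|exact: dg0].
have [|r rh Er] := @MVT_line ('D_u f) (x + s *: u) v h h0.
  by move=> r rh; have [+ _] := fD u; apply; exact: Uh.
exists s, r; split=> //; rewrite -Er -/(g (x + h *: u)) -/(g x) Es; congr (_ * _).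
rewrite (@deriveB _ _ _ (fun y => f (y + h *: v) : R^o) f) ?Dshift//.
  exact/diff_derivable/dg1.
exact/diff_derivable/dg0.
Qed.

(** The same second difference equals [h^2] times either mixed derivative, each
    taken at a point close to [x]; a gap [2 e] between the two values at [x]
    contradicts their continuity. *)
Lemma Schwarz (U : set V) (f : V -> R^o) (x u v : V) : open U -> U x ->
  Ck 2 U f -> 'D_u ('D_v f) x = 'D_v ('D_u f) x.
Proof.
move=> Uo Ux fk; have [fd fD] := fk; apply/eqP/negP => /negP AB.
pose e := `|'D_u ('D_v f) x - 'D_v ('D_u f) x| / 2.
have e0 : 0 < e by rewrite divr_gt0// normr_gt0 subr_eq0.
have close (g : V -> R^o) : {for x, continuous g} ->
    \forall y \near x, `|g x - g y| < e.
  by move=> gc; have /cvgrPdist_lt := gc; apply.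
have c1 : \forall y \near x, `|'D_u ('D_v f) x - 'D_u ('D_v f) y| < e.
  by apply: close; have [_ cD] := fD v; exact: cD.
have c2 : \forall y \near x, `|'D_v ('D_u f) x - 'D_v ('D_u f) y| < e.
  by apply: close; have [_ cD] := fD u; exact: cD.
have near_x : \forall y \near x, [/\ U y,
    `|'D_u ('D_v f) x - 'D_u ('D_v f) y| < e &
    `|'D_v ('D_u f) x - 'D_v ('D_u f) y| < e].
  have Ux' : \forall y \near x, U y by exact: open_nbhs_nbhs.
  by apply: filterS3 Ux' c1 c2 => y.
have /nbhs_normP[r /= r0 xr] := near_x.
(* The parallelogram then stays in the ball of radius [r]; the [+ 1] covers
   [u = v = 0]. *)
pose h := r / (`|u| + `|v| + 1).
have uv0 : 0 < `|u| + `|v| + 1 by rewrite ltr_wpDl// addr_ge0.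
have h0 : 0 < h by rewrite divr_gt0.
have small s t : 0 <= s <= h -> 0 <= t <= h -> `|x - (x + s *: u + t *: v)| < r.
  move=> /andP[s0 sh] /andP[t0 th]; rewrite -addrA opprD addNKr normrN.
  apply: (le_lt_trans (ler_normD _ _)); rewrite !normrZ (ger0_norm s0) (ger0_norm t0).
  apply: (@le_lt_trans _ _ (h * (`|u| + `|v|))).
    by rewrite mulrDr lerD// ler_wpM2r.
  by rewrite /h mulrAC ltr_pdivrMr// ltr_pM2l// ltrDl.
have [s [t [sh th E1]]] := @second_difference U f x u v h (ltW h0) fk
  (fun s t sh th => let: And3 Uy _ _ := xr _ (small s t sh th) in Uy).
have small' s' t' : 0 <= s' <= h -> 0 <= t' <= h ->
    `|x - (x + s' *: v + t' *: u)| < r.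
  by move=> sh' th'; rewrite addrAC; exact: small.
have [s' [t' [sh' th' E2]]] := @second_difference U f x v u h (ltW h0) fk
  (fun s t sh th => let: And3 Uy _ _ := xr _ (small' s t sh th) in Uy).
have E : 'D_v ('D_u f) (x + s *: u + t *: v) = 'D_u ('D_v f) (x + s' *: v + t' *: u).
  apply: (@mulfI _ h); first by rewrite gt_eqF.
  apply: (@mulfI _ h); first by rewrite gt_eqF.
  apply: (etrans (esym E1)); apply: etrans E2.
  rewrite [in RHS](addrAC x); move: (f (x + _ + _)) (f (x + h *: u)) (f (x + h *: v)).
  by move=> a b c; ring.
have [_ _ B] := xr _ (small s t sh th).
have [_ A _] := xr _ (small' s' t' sh' th').
have tri (a b c c' : R) : c = c' -> `|a - c'| < e -> `|b - c| < e ->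
    `|a - b| < e + e.
  move=> -> ac bc; rewrite -(subrKA c').
  by apply: (le_lt_trans (ler_normD _ _) (ltrD ac _)); rewrite distrC; exact: bc.
have := tri _ _ _ _ E A B.
by rewrite -splitr ltxx.
Qed.

End Schwarz.

(** * Activity and transport coefficients for equal diameters *)

Lemma sum_gt0 (R : realType) (N : nat) (F : 'I_N -> R) :
  (0 < N)%N -> (forall i, 0 < F i) -> 0 < \sum_i F i.
Proof.
case: N F => // N F _ F0; rewrite big_ord_recl ltr_pwDl//.
by apply: sumr_ge0 => i _; exact: ltW.
Qed.

Section EqualDiameters.
Context {R : realType} {N : nat} {P : params R N} {s : R}.
Hypotheses (hP : wf_params P) (hs : forall k, sigma P k = s).
Implicit Types n : 'I_N -> R.

Definition total_conc n : R := \sum_k n k.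
Definition ionic_strength n : R := \sum_k n k * zR P k ^+ 2.

Lemma diameter_gt0 : 0 < s.
Proof. by rewrite -(hs (Ordinal (N_gt0 hP))); exact: sigma_gt0. Qed.

Lemma zR_neq0 k : zR P k != 0.
Proof. by rewrite intr_eq0; exact: z_neq0. Qed.

Lemma zR2_gt0 k : 0 < zR P k ^+ 2.
Proof. by rewrite exprn_even_gt0//= zR_neq0. Qed.

Lemma ionic_strength_gt0 n : (forall k, 0 < n k) -> 0 < ionic_strength n.
Proof. by move=> n0; apply: (sum_gt0 (N_gt0 hP)) => k; rewrite mulr_gt0// zR2_gt0. Qed.

(** The positive root [g] of [a g^2 + g = sqrt I], with [a = Gammac s]. *)
Definition screening (I : R) : R :=
  (Num.sqrt (1 + 4 * (Gammac P * s) * Num.sqrt I) - 1) / (2 * (Gammac P * s)).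

Let Gc_gt0 : 0 < Gammac P := Gammac_gt0 hP.
Let s_gt0 : 0 < s := diameter_gt0.

Let a_gt0 : 0 < Gammac P * s.
Proof. exact: mulr_gt0. Qed.

Lemma screening_gt0 (I : R) : 0 < I -> 0 < screening I.
Proof.
move=> I0; apply: divr_gt0; last by rewrite mulr_gt0.
have r0 : 0 < 4 * (Gammac P * s) * Num.sqrt I by rewrite mulr_gt0 ?mulr_gt0// sqrtr_gt0.
by rewrite subr_gt0 -[ltLHS]sqrtr1 ltr_sqrt ?ltrDl// addr_gt0.
Qed.

Lemma screening_eq (I : R) : 0 < I ->
  screening I * (1 + Gammac P * screening I * s) = Num.sqrt I.
Proof.
move=> I0; set r := Num.sqrt I; have r0 : 0 < r by rewrite sqrtr_gt0.
rewrite /screening -/r [Gammac P * _ * s]mulrAC; have := a_gt0.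
move: (Gammac P * s) => a a0; have an0 : a != 0 by rewrite gt_eqF.
set q := Num.sqrt _; have qE : q ^+ 2 = 1 + 4 * a * r.
  by rewrite sqr_sqrtr// ltW// addr_gt0// mulr_gt0 ?mulr_gt0.
have -> : (q - 1) / (2 * a) * (1 + a * ((q - 1) / (2 * a))) =
    (q ^+ 2 - 1) / (4 * a) by field; rewrite an0.
by rewrite qE; field; rewrite an0.
Qed.

(** [a g^2 + g] is injective on the positive axis, so the positive solution is
    unique. *)
Lemma GamE n : (forall k, 0 < n k) -> Gam P n = screening (ionic_strength n).
Proof.
move=> n0; have I0 := ionic_strength_gt0 n0.
have sumE (g : R) :
    \sum_k n k * zR P k ^+ 2 / (1 + Gammac P * g * sigma P k) ^+ 2 =
    ionic_strength n / (1 + Gammac P * g * s) ^+ 2.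
  by rewrite /ionic_strength mulr_suml; apply: eq_bigr => k _; rewrite hs.
have d0 (g : R) : 0 < g -> 0 < 1 + Gammac P * g * s.
  by move=> g0; rewrite addr_gt0// !mulr_gt0.
have g0 := screening_gt0 I0.
apply: xget_unique => [|g [g1]] /=; rewrite sumE.
  split=> //; apply: (canRL (mulfK _)); first by rewrite expf_neq0// gt_eqF ?d0.
  by rewrite -exprMn screening_eq// sqr_sqrtr// ltW.
have D := d0 _ g1.
move=> g2; have E : (g * (1 + Gammac P * g * s)) ^+ 2 = ionic_strength n.
  by rewrite exprMn g2 divfK// expf_neq0// gt_eqF.
have {}E : g * (1 + Gammac P * g * s) = Num.sqrt (ionic_strength n).
  by rewrite -E sqrtr_sqr ger0_norm// mulr_ge0// ltW.
move: E; rewrite -screening_eq//; move: (screening _) g0 => g' g0 E.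
have /eqP : (g - g') * (1 + Gammac P * s * (g + g')) = 0.
  rewrite (_ : _ * _ = g * (1 + Gammac P * g * s) - g' * (1 + Gammac P * g' * s)).
    by rewrite E subrr.
  by ring.
rewrite mulf_eq0 subr_eq0 => /orP[/eqP //|].
by rewrite gt_eqF// addr_gt0// mulr_gt0// addr_gt0.
Qed.

Lemma Gam_gt0 n : (forall k, 0 < n k) -> 0 < Gam P n.
Proof. by move=> n0; rewrite GamE// screening_gt0// ionic_strength_gt0. Qed.

Lemma Gam_sqr n : (forall k, 0 < n k) ->
  Gam P n ^+ 2 =
  \sum_k n k * zR P k ^+ 2 / (1 + Gammac P * Gam P n * sigma P k) ^+ 2.
Proof.
move=> n0; have I0 := ionic_strength_gt0 n0; have g0 := screening_gt0 I0.
rewrite GamE//; apply/esym.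
transitivity (ionic_strength n / (1 + Gammac P * screening (ionic_strength n) * s) ^+ 2).
  by rewrite [in RHS]/ionic_strength mulr_suml; apply: eq_bigr => k _; rewrite hs.
apply: (canLR (mulfK _)).
  by rewrite expf_neq0// gt_eqF// addr_gt0// mulr_gt0// mulr_gt0.
by rewrite -exprMn screening_eq// sqr_sqrtr// ltW.
Qed.

Lemma Ck_screening k : Ck k [set I : R^o | 0 < I] (screening : R^o -> R^o).
Proof.
have Jo : open [set I : R^o | 0 < I] by exact: open_gt.
apply: (Ck_mul Jo); last exact: Ck_cst.
apply: (Ck_add Jo); last exact: Ck_cst.
apply: (Ck_sqrt Jo) => [I I0|].
  by rewrite addr_gt0// mulr_gt0 ?mulr_gt0// sqrtr_gt0.
apply: (Ck_add Jo); first exact: Ck_cst.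
apply: (Ck_mul Jo); first exact: Ck_cst.
exact: Ck_sqrtR.
Qed.

Lemma Gdim_gt0 n : (forall k, 0 < n k) -> 0 < Gdim P n.
Proof. by move=> n0; rewrite mulr_gt0// Gam_gt0. Qed.

Lemma cdim_gt0 n i : (forall k, 0 < n k) -> 0 < cdim P n i.
Proof. by move=> n0; rewrite mulr_gt0//; exact: nc_gt0. Qed.

Lemma damping_gt0 n i : (forall k, 0 < n k) -> 0 < 1 + Gdim P n * sigma P i.
Proof.
by move=> n0; rewrite addr_gt0// mulr_gt0 ?Gdim_gt0//; exact: sigma_gt0.
Qed.

Lemma Xmom_gt0 n m : (forall k, 0 < n k) -> 0 < Xmom P n m.
Proof.
move=> n0; rewrite mulr_gt0 ?divr_gt0 ?pi_gt0//.
apply: (sum_gt0 (N_gt0 hP)) => i.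
by rewrite mulr_gt0 ?cdim_gt0// exprn_gt0//; exact: sigma_gt0.
Qed.

Lemma X3tilde_gt0 n : (forall k, 0 < n k) -> 0 < X3tilde P n.
Proof.
move=> n0; rewrite mulr_gt0 ?divr_gt0 ?pi_gt0//.
apply: (sum_gt0 (N_gt0 hP)) => i; have X0 m := Xmom_gt0 m n0.
rewrite mulr_gt0 ?cdim_gt0//; apply: divr_gt0; last by rewrite mulr_gt0 ?exprn_gt0.
by rewrite addr_gt0// mulr_gt0// mulr_gt0.
Qed.

Lemma kappaq_arg_gt0 n : (forall k, 0 < n k) ->
  0 < echarge P ^+ 2 / (calE P * kBT P) *
      ((\sum_i cdim P n i * zR P i ^+ 2 * D0 P i) / \sum_i D0 P i).
Proof.
move=> n0; have D0 i : 0 < D0 P i by exact: D0_gt0.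
apply: mulr_gt0.
  by rewrite divr_gt0 ?exprn_gt0 ?mulr_gt0 ?(echarge_gt0 hP) ?(calE_gt0 hP) ?(kBT_gt0 hP).
apply: divr_gt0.
  apply: (sum_gt0 (N_gt0 hP)) => i.
  by apply: mulr_gt0 => //; rewrite mulr_gt0 ?cdim_gt0 ?zR2_gt0.
exact: (sum_gt0 (N_gt0 hP)).
Qed.

Lemma Omega_c_den_gt0 n : (forall k, 0 < n k) ->
  0 < Gdim P n + \sum_k cdim P n k *
    (pi * LB P * zR P k ^+ 2 * sigma P k / (1 + Gdim P n * sigma P k) ^+ 2).
Proof.
move=> n0; rewrite ltr_pwDl ?Gdim_gt0//; apply: sumr_ge0 => k _; apply: ltW.
rewrite mulr_gt0 ?cdim_gt0// divr_gt0 ?exprn_gt0 ?damping_gt0//.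
have z0 := zR2_gt0 k; have := sigma_gt0 hP k; have := LB_gt0 hP; have := pi_gt0 R.
by move=> pi0 LB0 sk0; rewrite mulr_gt0// mulr_gt0// mulr_gt0.
Qed.

(** The defining equation of [Gam] reads
    [G^2 = pi LB sum_k c_k z_k^2 / (1 + G sigma_k)^2], so that the negative
    term of this denominator is dominated by [2 G^2]. *)
Lemma Rrel_den_gt0 n : (forall k, 0 < n k) ->
  0 < kappaq P n ^+ 2 + 2 * Gdim P n * kappaq P n + 2 * Gdim P n ^+ 2
    - 2 * pi * LB P *
      \sum_k cdim P n k * (zR P k ^+ 2 * expR (- (kappaq P n * sigma P k))
                       / (1 + Gdim P n * sigma P k) ^+ 2).
Proof.
move=> n0; have k0 : 0 < kappaq P n by rewrite sqrtr_gt0 kappaq_arg_gt0.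
have G0 := Gdim_gt0 n0; have LB0 := LB_gt0 hP; have nc0 := nc_gt0 hP.
have pi0 : 0 < pi :> R by exact: pi_gt0.
have G2 : Gdim P n ^+ 2 = pi * LB P *
    \sum_k cdim P n k * (zR P k ^+ 2 / (1 + Gdim P n * sigma P k) ^+ 2).
  have Gc2 : Gammac P ^+ 2 = pi * LB P * nc P.
    by rewrite [in LHS](Gammac_def hP) sqr_sqrtr// ltW// mulr_gt0// mulr_gt0.
  rewrite {1}/Gdim exprMn Gam_sqr// Gc2 !mulr_sumr.
  by apply: eq_bigr => k _; rewrite /cdim /Gdim !mulrA.
rewrite -addrA ltr_pwDl//.
  by rewrite addr_gt0 ?exprn_gt0// mulr_gt0// mulr_gt0.
rewrite subr_ge0 G2 -!mulrA !ler_pM2l//; apply: ler_sum => k _.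
rewrite ler_pM2l ?cdim_gt0// -mulrA ler_pM2l ?zR2_gt0//.
apply: ler_piMl; first by rewrite invr_ge0 exprn_ge0// ltW// damping_gt0.
by rewrite expR_le1 oppr_le0 ltW// mulr_gt0//; exact: sigma_gt0.
Qed.

Definition log_activity n j : R := ln (n j * act_coef P n j).

(** The contribution of the hard spheres to [ln gamma_j], as a function of the
    total concentration: with equal diameters the packing fraction is a multiple
    of it. *)
Definition packing_term (r : R) : R := pHS (xic P * (r * (s / sigmac P) ^+ 3)).

(** The electrostatic contribution to [ln gamma_j], divided by [z_j^2]. *)
Definition screening_term (I : R) : R :=
  - (LB P * screening I * Gammac P / (1 + screening I * Gammac P * s)).

Lemma xiE n : xi P n = xic P * (total_conc n * (s / sigmac P) ^+ 3).
Proof.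
rewrite /xi /total_conc mulr_suml; congr (_ * _).
by apply: eq_bigr => i _; rewrite hs.
Qed.

Lemma log_activityE n j : (forall i, 0 < n i) ->
  log_activity n j = ln (n j) + packing_term (total_conc n)
                     + zR P j ^+ 2 * screening_term (ionic_strength n).
Proof.
move=> n0; rewrite /log_activity lnM ?posrE ?expR_gt0// expRK -addrA.
congr (_ + _); rewrite /packing_term -xiE; congr (_ + _).
by rewrite /screening_term -GamE// hs; ring.
Qed.

Lemma Ck_pHS m : Ck m [set r : R^o | r < 1] (@pHS R : R^o -> R^o).
Proof.
have Jo : open [set r : R^o | r < 1] by exact: open_lt.
have idk := @Ck_id R m [set r : R^o | r < 1].
apply: (Ck_mul Jo idk); apply: (Ck_mul Jo).
  apply: (Ck_add Jo).
    apply: (Ck_add Jo); first exact: Ck_cst.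
    by apply: (Ck_opp Jo); apply: (Ck_mul Jo _ idk); exact: Ck_cst.
  by apply: (Ck_mul Jo _ (Ck_pow 2 Jo idk)); exact: Ck_cst.
apply: (Ck_inv Jo) => [r r1|]; first by rewrite expf_neq0// gt_eqF// subr_gt0.
apply: (Ck_pow 3 Jo); apply: (Ck_add Jo); first exact: Ck_cst.
exact: (Ck_opp Jo).
Qed.

Lemma packing_lt1_open :
  open [set r : R^o | xic P * (r * (s / sigmac P) ^+ 3) < 1].
Proof.
apply: (@open_comp _ _ (fun r : R^o => xic P * (r * (s / sigmac P) ^+ 3))
  [set r : R^o | r < 1]); last exact: open_lt.
move=> r _; have : Ck 0 setT
    ((fun r => xic P * (r * (s / sigmac P) ^+ 3)) : R^o -> R^o); last exact.
apply: (Ck_mul openT); first exact: Ck_cst.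
by apply: (Ck_mul openT); [exact: Ck_id|exact: Ck_cst].
Qed.

Lemma Ck_packing_term m :
  Ck m [set r : R^o | xic P * (r * (s / sigmac P) ^+ 3) < 1]
    (packing_term : R^o -> R^o).
Proof.
have Jo := packing_lt1_open.
apply: (Ck_comp Jo _ (Ck_pHS m)) => //.
apply: (Ck_mul Jo); first exact: Ck_cst.
by apply: (Ck_mul Jo); [exact: Ck_id|exact: Ck_cst].
Qed.

Lemma Ck_screening_term m :
  Ck m [set I : R^o | 0 < I] (screening_term : R^o -> R^o).
Proof.
have Jo : open [set I : R^o | 0 < I] by exact: open_gt.
have gk := Ck_screening m.
apply: (Ck_opp Jo); apply: (Ck_mul Jo).
  apply: (Ck_mul Jo); last exact: Ck_cst.
  by apply: (Ck_mul Jo _ gk); exact: Ck_cst.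
apply: (Ck_inv Jo) => [I I0|].
  have g0 := screening_gt0 I0.
  by rewrite gt_eqF// addr_gt0// mulr_gt0// mulr_gt0.
apply: (Ck_add Jo); first exact: Ck_cst.
by do 2 (apply: (Ck_mul Jo); last exact: Ck_cst).
Qed.

Section SmoothCoefficients.
Context {V : normedModType R}.
Variables (k : nat) (U : set V) (n : 'I_N -> V -> R^o).
Hypotheses (Uo : open U) (nk : forall i, Ck k U (n i)).
Hypothesis (n_gt0 : forall i x, U x -> 0 < n i x).

Let n0 x : U x -> forall i, 0 < n i x.
Proof. by move=> Ux i; exact: n_gt0. Qed.

Lemma Ck_ionic_strength :
  Ck k U ((fun x => ionic_strength (fun i => n i x)) : V -> R^o).
Proof. by apply: Ck_sum => // i; apply: Ck_mul => //; exact: Ck_cst. Qed.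

Lemma Ck_total_conc : Ck k U ((fun x => total_conc (fun i => n i x)) : V -> R^o).
Proof. exact: Ck_sum. Qed.

Lemma Ck_Gam : Ck k U ((fun x => Gam P (fun i => n i x)) : V -> R^o).
Proof.
apply: (Ck_ext Uo) (Ck_comp Uo _ (Ck_screening k) Ck_ionic_strength) => x Ux.
  by rewrite GamE// => i; exact: n_gt0.
exact/ionic_strength_gt0/n0.
Qed.

Lemma Ck_Gdim : Ck k U ((fun x => Gdim P (fun i => n i x)) : V -> R^o).
Proof. by apply: Ck_mul Ck_Gam => //; exact: Ck_cst. Qed.

Lemma Ck_cdim i : Ck k U ((fun x => cdim P (fun i => n i x) i) : V -> R^o).
Proof. by apply: Ck_mul (nk i) => //; exact: Ck_cst. Qed.

Lemma Ck_damping i :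
  Ck k U ((fun x => 1 + Gdim P (fun i => n i x) * sigma P i) : V -> R^o).
Proof.
apply: (Ck_add Uo); first exact: Ck_cst.
by apply: (Ck_mul Uo Ck_Gdim); exact: Ck_cst.
Qed.

Lemma Ck_Omega_c i j : Ck k U ((fun x => Omega_c P (fun i => n i x) i j) : V -> R^o).
Proof.
apply: (Ck_mul Uo); first exact: Ck_cst.
apply: (Ck_mul Uo).
  by apply: (Ck_mul Uo); [exact: Ck_cst|exact: Ck_cdim].
apply: (Ck_inv Uo) => [x Ux|].
  by rewrite !mulf_neq0// gt_eqF ?damping_gt0 ?Omega_c_den_gt0//; exact: n0.
apply: (Ck_mul Uo); first by apply: (Ck_mul Uo); exact: Ck_damping.
apply: (Ck_add Uo Ck_Gdim); apply: (Ck_sum _ Uo) => l.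
apply: (Ck_mul Uo (Ck_cdim l)); apply: (Ck_mul Uo); first exact: Ck_cst.
apply: (Ck_inv Uo) => [x Ux|]; last exact: (Ck_pow _ Uo (Ck_damping l)).
by rewrite expf_neq0// gt_eqF// damping_gt0//; exact: n0.
Qed.

Lemma Ck_Xmom m : Ck k U ((fun x => Xmom P (fun i => n i x) m) : V -> R^o).
Proof.
apply: (Ck_mul Uo); first exact: Ck_cst.
apply: (Ck_sum _ Uo) => l; apply: (Ck_mul Uo (Ck_cdim l)); exact: Ck_cst.
Qed.

Lemma Ck_X3tilde : Ck k U ((fun x => X3tilde P (fun i => n i x)) : V -> R^o).
Proof.
apply: (Ck_mul Uo); first exact: Ck_cst.
apply: (Ck_sum _ Uo) => l; apply: (Ck_mul Uo (Ck_cdim l)).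
apply: (Ck_mul Uo).
  apply: (Ck_add Uo); last by apply: (Ck_mul Uo); exact: Ck_Xmom.
  by do 2 (apply: (Ck_mul Uo); last exact: Ck_Xmom); exact: Ck_cst.
apply: (Ck_inv Uo) => [x Ux|].
  by rewrite mulf_neq0// expf_neq0// gt_eqF// Xmom_gt0//; exact: n0.
by apply: (Ck_mul Uo); [exact: Ck_cst|exact: (Ck_pow _ Uo (Ck_Xmom 0))].
Qed.

Lemma Ck_Omega_HS i j :
  Ck k U ((fun x => Omega_HS P (fun i => n i x) i j) : V -> R^o).
Proof.
apply: (Ck_mul Uo).
  by apply: (Ck_mul Uo); [exact: Ck_cst|exact: Ck_cdim].
apply: (Ck_mul Uo).
  apply: (Ck_add Uo).
    apply: (Ck_add Uo); first exact: Ck_cst.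
    by apply: (Ck_opp Uo); apply: (Ck_mul Uo Ck_X3tilde); exact: Ck_cst.
  by apply: (Ck_mul Uo (Ck_pow _ Uo Ck_X3tilde)); exact: Ck_cst.
apply: (Ck_inv Uo) => [x Ux|].
  by rewrite gt_eqF// addr_gt0// mulr_gt0// X3tilde_gt0//; exact: n0.
apply: (Ck_add Uo); first exact: Ck_cst.
by apply: (Ck_mul Uo _ Ck_X3tilde); exact: Ck_cst.
Qed.

Lemma Ck_kappaq : Ck k U ((fun x => kappaq P (fun i => n i x)) : V -> R^o).
Proof.
apply: (Ck_sqrt Uo) => [x Ux|]; first exact/kappaq_arg_gt0/n0.
apply: (Ck_mul Uo); first exact: Ck_cst.
apply: (Ck_mul Uo); last exact: Ck_cst.
apply: (Ck_sum _ Uo) => l; do 2 (apply: (Ck_mul Uo); last exact: Ck_cst).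
exact: Ck_cdim.
Qed.

Lemma Ck_exp_kappaq (a : R) :
  Ck k U ((fun x => expR (- (kappaq P (fun i => n i x) * a))) : V -> R^o).
Proof.
apply: (Ck_exp Uo); apply: (Ck_opp Uo); apply: (Ck_mul Uo Ck_kappaq).
exact: Ck_cst.
Qed.

Lemma Ck_Rrel i j : Ck k U ((fun x => Rrel P (fun i => n i x) i j) : V -> R^o).
Proof.
apply: (Ck_mul Uo).
  apply: (Ck_mul Uo).
    do 3 (apply: (Ck_mul Uo); last exact: Ck_cst).
    exact: (Ck_pow _ Uo Ck_kappaq).
  apply: (Ck_inv Uo) => [x Ux|].
    rewrite !mulf_neq0 ?gt_eqF ?damping_gt0 ?addr_gt0 ?(sigma_gt0 hP)
      ?(calE_gt0 hP) ?(kBT_gt0 hP)//; exact: n0.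
  apply: (Ck_mul Uo); last exact: Ck_damping.
  by apply: (Ck_mul Uo); [exact: Ck_cst|exact: Ck_damping].
apply: (Ck_mul Uo).
  apply: (Ck_add Uo); first exact: Ck_cst.
  apply: (Ck_opp Uo).
  apply: (Ck_ext Uo) (Ck_exp_kappaq (2 * (sigma P i + sigma P j))) => x _.
  by rewrite mulrCA !mulrA.
apply: (Ck_inv Uo) => [x Ux|]; first by rewrite gt_eqF// Rrel_den_gt0//; exact: n0.
apply: (Ck_add Uo).
  apply: (Ck_add Uo); last first.
    by apply: (Ck_mul Uo); [exact: Ck_cst|exact: (Ck_pow _ Uo Ck_Gdim)].
  apply: (Ck_add Uo); first exact: (Ck_pow _ Uo Ck_kappaq).
  apply: (Ck_mul Uo _ Ck_kappaq); apply: (Ck_mul Uo _ Ck_Gdim); exact: Ck_cst.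
apply: (Ck_opp Uo); apply: (Ck_mul Uo); first exact: Ck_cst.
apply: (Ck_sum _ Uo) => l; apply: (Ck_mul Uo (Ck_cdim l)); apply: (Ck_mul Uo).
  by apply: (Ck_mul Uo); [exact: Ck_cst|exact: Ck_exp_kappaq].
apply: (Ck_inv Uo) => [x Ux|]; last exact: (Ck_pow _ Uo (Ck_damping l)).
by rewrite expf_neq0// gt_eqF// damping_gt0//; exact: n0.
Qed.

Lemma Ck_Kmat i j : Ck k U ((fun x => Kmat P (fun i => n i x) i j) : V -> R^o).
Proof.
apply: (Ck_mul Uo).
  apply: (Ck_add Uo); first exact: Ck_cst.
  apply: (Ck_mul Uo); first exact: Ck_cst.
  by apply: (Ck_add Uo); [exact: Ck_Omega_c|exact: Ck_Omega_HS].
by apply: (Ck_add Uo); [exact: Ck_cst|exact: Ck_Rrel].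
Qed.

Hypothesis xi_lt1 : forall x, U x -> xi P (fun i => n i x) < 1.

Lemma Ck_log_activity j :
  Ck k U ((fun x => log_activity (fun i => n i x) j) : V -> R^o).
Proof.
apply: (Ck_ext Uo (f := (fun x => ln (n j x)
    + packing_term (total_conc (fun i => n i x))
    + zR P j ^+ 2 * screening_term (ionic_strength (fun i => n i x))))).
  by move=> x Ux; rewrite log_activityE//; exact: n0.
apply: (Ck_add Uo).
  apply: (Ck_add Uo); first exact: (Ck_ln Uo (@n_gt0 j)).
  apply: (Ck_comp Uo _ (Ck_packing_term k) Ck_total_conc) => x Ux.
  by rewrite /= -xiE xi_lt1.
apply: (Ck_mul Uo); first exact: Ck_cst.
apply: (Ck_comp Uo _ (Ck_screening_term k) Ck_ionic_strength) => x Ux.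
exact/ionic_strength_gt0/n0.
Qed.

End SmoothCoefficients.

(** The bilinear form of a diagonal matrix plus two symmetric matrices of rank
    one, written so that its symmetry in [a] and [b] is visible. *)
Let sum_rank2 (A B : R) (a c z b : 'I_N -> R) :
  \sum_j a j * (c j * b j + A * (\sum_i b i) + z j * (B * \sum_i z i * b i)) =
  \sum_j a j * b j * c j + A * ((\sum_i a i) * (\sum_i b i))
  + B * ((\sum_i z i * a i) * (\sum_i z i * b i)).
Proof.
move: (\sum_i b i) (\sum_i z i * b i) => sb zb.
rewrite [in X in _ + A * X]mulr_suml [in X in _ + B * X]mulr_suml !mulr_sumr.
by rewrite -!big_split; apply: eq_bigr => j _ /=; ring.
Qed.

Section Symmetry.
Context {V : normedModType R}.
Variables (U : set V) (n : 'I_N -> V -> R^o).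
Hypotheses (Uo : open U) (nk : forall i, Ck 1 U (n i)).
Hypothesis (n_gt0 : forall i x, U x -> 0 < n i x).
Hypothesis xi_lt1 : forall x, U x -> xi P (fun i => n i x) < 1.

Let n0 x : U x -> forall i, 0 < n i x.
Proof. by move=> Ux i; exact: n_gt0. Qed.

Lemma derive_log_activity j x v : U x ->
  let s x := total_conc (fun i => n i x) : R^o in
  let I x := ionic_strength (fun i => n i x) : R^o in
  'D_v ((fun x => log_activity (fun i => n i x) j) : V -> R^o) x =
  (n j x)^-1 * 'D_v (n j) x
  + 'D_1 (packing_term : R^o -> R^o) (s x) * \sum_i 'D_v (n i) x
  + zR P j ^+ 2 * ('D_1 (screening_term : R^o -> R^o) (I x)
                   * \sum_i zR P i ^+ 2 * 'D_v (n i) x).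
Proof.
move=> Ux s' I.
have dn i : differentiable (n i) x by exact: Ck_diff (nk i) Ux.
have ds : 'D_v s' x = \sum_i 'D_v (n i) x.
  rewrite -derive_sum; last by move=> i; exact/diff_derivable/dn.
  by congr ('D_v _ x); apply/funext => y; rewrite fct_sumE.
have dI : 'D_v I x = \sum_i zR P i ^+ 2 * 'D_v (n i) x.
  transitivity (\sum_i 'D_v (zR P i ^+ 2 *: n i : V -> R^o) x).
    rewrite -derive_sum; last by move=> i; exact/derivableZ/diff_derivable/dn.
    congr ('D_v _ x); apply/funext => y; rewrite fct_sumE.
    by apply: eq_bigr => i _; rewrite mulrC.
  by apply: eq_bigr => i _; rewrite deriveZ//; exact/diff_derivable/dn.
have ds' : differentiable s' x by exact: Ck_diff (Ck_total_conc Uo nk) Ux.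
have dI' : differentiable I x by exact: Ck_diff (Ck_ionic_strength Uo nk) Ux.
have dp : differentiable (packing_term : R^o -> R^o) (s' x).
  by apply: (Ck_diff (Ck_packing_term 1)); rewrite /= -xiE xi_lt1.
have dt : differentiable (screening_term : R^o -> R^o) (I x).
  by apply: (Ck_diff (Ck_screening_term 1)); exact/ionic_strength_gt0/n0.
have dl : differentiable (@ln R : R^o -> R^o) (n j x).
  by apply: (Ck_diff (Ck_lnR 1)); exact: n_gt0.
have lE : 'D_1 (@ln R : R^o -> R^o) (n j x) = (n j x)^-1.
  by have [_] := is_derive1_ln (n_gt0 j Ux).
rewrite -ds -dI -lE -!derive_comp1//.
transitivity ('D_v (((@ln R : R^o -> R^o) \o n j)
    + ((packing_term : R^o -> R^o) \o s')
    + (zR P j ^+ 2 *: ((screening_term : R^o -> R^o) \o I)) : V -> R^o) x).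
  by apply: (derive_ext _ Uo Ux) => y Uy; rewrite log_activityE//; exact: n0.
have d1 := @diff_derivable _ _ _ _ _ v (differentiable_comp (dn j) dl).
have d2 := @diff_derivable _ _ _ _ _ v (differentiable_comp ds' dp).
have d3 := @diff_derivable _ _ _ _ _ v (differentiable_comp dI' dt).
move: (_ \o _) (_ \o s') (_ \o I) d1 d2 d3 => f1 f2 f3 d1 d2 d3.
rewrite deriveD; [|exact: derivableD|exact: derivableZ].
by rewrite deriveD// deriveZ.
Qed.

(** With a common diameter the matrix
    [d ln (n_j gamma_j) / d n_k = delta_jk / n_j + A + z_j^2 z_k^2 B],
    with [A] and [B] independent of [j] and [k], is symmetric; so is the bilinear
    form that it defines. *)
Lemma log_activity_symmetry x u v : U x ->
  \sum_j 'D_u (n j) x *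
     'D_v ((fun y => log_activity (fun i => n i y) j) : V -> R^o) x =
  \sum_j 'D_v (n j) x *
     'D_u ((fun y => log_activity (fun i => n i y) j) : V -> R^o) x.
Proof.
move=> Ux; pose a w j : R := 'D_w (n j) x; pose z j := zR P j ^+ 2.
pose A : R := 'D_1 (packing_term : R^o -> R^o) (total_conc (fun i => n i x)).
pose B : R := 'D_1 (screening_term : R^o -> R^o) (ionic_strength (fun i => n i x)).
pose form w w' := \sum_j a w j * a w' j * (n j x)^-1
  + A * ((\sum_i a w i) * (\sum_i a w' i))
  + B * ((\sum_i z i * a w i) * (\sum_i z i * a w' i)).
have formE w w' : \sum_j 'D_w (n j) x *
    'D_w' ((fun y => log_activity (fun i => n i y) j) : V -> R^o) x = form w w'.
  apply: etrans (sum_rank2 A B (a w) (fun j => (n j x)^-1) z (a w')).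
  by apply: eq_bigr => j _; congr (_ * _); exact: derive_log_activity.
apply: (etrans (formE u v)); apply: etrans (esym (formE v u)).
rewrite /form; clearbody a A B z; clear form formE.
rewrite [in X in _ + A * X]mulrC [in X in _ + B * X]mulrC.
by congr (_ + _ + _); apply: eq_bigr => j _; rewrite [X in X / _]mulrC.
Qed.

End Symmetry.

End EqualDiameters.

Arguments log_activity {R N} P n j.

(** * Space and time derivatives of a family of fields *)

(** Sums and products of derivatives are compared term by term with these rules:
    the terms are limits, whose equality is a theorem and never a conversion. *)
Lemma eq_add (R : pzRingType) (a b c d : R) : a = c -> b = d -> a + b = c + d.
Proof. by move=> -> ->. Qed.

Lemma eq_sub (R : pzRingType) (a b c d : R) : a = c -> b = d -> a - b = c - d.
Proof. by move=> -> ->. Qed.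

Lemma eq_mul (R : pzRingType) (a b c d : R) : a = c -> b = d -> a * b = c * d.
Proof. by move=> -> ->. Qed.

Section DeriveRules.
Context {R : realType} {V : normedModType R}.
Implicit Types (f g : V -> R^o) (x v : V).

Lemma derive_add f g x v : differentiable f x -> differentiable g x ->
  'D_v (fun y => f y + g y : R^o) x = 'D_v f x + 'D_v g x.
Proof. by move=> df dg; apply: (@deriveD _ _ _ f g); exact: diff_derivable. Qed.

Lemma derive_sub f g x v : differentiable f x -> differentiable g x ->
  'D_v (fun y => f y - g y : R^o) x = 'D_v f x - 'D_v g x.
Proof. by move=> df dg; apply: (@deriveB _ _ _ f g); exact: diff_derivable. Qed.

Lemma derive_mul f g x v : differentiable f x -> differentiable g x ->
  'D_v (fun y => f y * g y : R^o) x = 'D_v f x * g x + f x * 'D_v g x.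
Proof.
move=> df dg; apply: etrans (_ : f x *: 'D_v g x + g x *: 'D_v f x = _).
  by apply: (@deriveM _ _ f g); exact: diff_derivable.
by rewrite addrC [g x *: _]mulrC.
Qed.

Lemma derive_mull (c : R) f x v : differentiable f x ->
  'D_v (fun y => c * f y : R^o) x = c * 'D_v f x.
Proof. by move=> df; apply: (@deriveZ _ _ _ f c); exact: diff_derivable. Qed.

Lemma derive_bigsum m (f : 'I_m -> V -> R^o) x v :
  (forall i, differentiable (f i) x) ->
  'D_v (fun y => \sum_i f i y : R^o) x = \sum_i 'D_v (f i) x.
Proof.
move=> df; rewrite -derive_sum; last by move=> i; exact: diff_derivable.
by congr ('D_v _ x); apply/funext => y; rewrite fct_sumE.
Qed.

End DeriveRules.

Lemma derive_affine (R : realType) (h : R -> R^o) (a b c t : R) :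
  derivable h t 1 ->
  'D_1 (fun r : R => a + b * h r - c * r : R^o) t = b * 'D_1 h t - c.
Proof.
move=> dh; have db : derivable (b *: h) t 1 by exact: derivableZ.
have da : derivable (cst (a : R^o) : R -> R^o) t 1 by exact: derivable_cst.
have did : derivable (id : R -> R^o) t 1 by exact: derivable_id.
have dc : derivable (c *: (id : R -> R^o)) t 1 by exact: derivableZ.
have dab : derivable ((cst (a : R^o) : R -> R^o) + b *: h) t 1 by exact: derivableD.
apply: (etrans (deriveB dab dc)).
have -> : 'D_1 ((cst (a : R^o) : R -> R^o) + b *: h) t = b * 'D_1 h t.
  by apply: (etrans (deriveD da db)); rewrite derive_cst add0r; exact: deriveZ.
congr (_ - _); apply: (etrans (deriveZ _ did)).
by rewrite (derive_id t 1); exact: mulr1.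
Qed.

Section SpaceTime.
Context {R : realType} {d : nat}.
Notation X := 'rV[R]_d.
Notation TX := (R^o * X)%type.
Context {W : normedModType R}.

Definition dt (g : TX -> W) : TX -> W := 'D_((1, 0) : TX) g.
Definition dx (k : 'I_d) (g : TX -> W) : TX -> W :=
  'D_((0, delta_mx 0 k) : TX) g.

Lemma Ck_dt m (U : set TX) (g : TX -> W) : Ck m.+1 U g -> Ck m U (dt g).
Proof. exact: Ck_derive. Qed.

Lemma Ck_dx m (U : set TX) k (g : TX -> W) : Ck m.+1 U g -> Ck m U (dx k g).
Proof. exact: Ck_derive. Qed.

Lemma first_variation_dt (f : R -> X -> W) (x : X) :
  first_variation f x = dt (fun tx : TX => f tx.1 tx.2) (0, x).
Proof.
rewrite /first_variation derive1E; apply: eq_derive => h.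
by rewrite /= scaler0 add0r.
Qed.

Lemma dt_line (g : TX -> W) (t : R) (x : X) :
  'D_1 (fun s : R => g (s, x)) t = dt g (t, x).
Proof.
apply: eq_derive => h; congr (g _ - _).
by rewrite -[h *: _ + (t, x)]/(h *: (1 : R^o) + t, h *: (0 : X) + x) scaler0 add0r.
Qed.

Lemma derivable_line (g : TX -> W) (t : R) (x : X) :
  differentiable g (t, x) -> derivable (fun s : R => g (s, x)) t 1.
Proof.
move=> /(@diff_derivable _ _ _ _ _ ((1, 0) : TX)); apply: eq_derivable => h.
congr (g _ - _).
by rewrite -[h *: _ + (t, x)]/(h *: (1 : R^o) + t, h *: (0 : X) + x) scaler0 add0r.
Qed.

End SpaceTime.

Section SpaceTimeReal.
Context {R : realType} {d : nat}.
Notation X := 'rV[R]_d.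
Notation TX := (R^o * X)%type.
Implicit Types (U : set TX) (g h : TX -> R^o).

Lemma near_dt_linear g (c : R) (x : X) :
  (\forall t \near (0 : R), g (t, x) = c * t) -> dt g (0, x) = c.
Proof.
move=> gc; apply: (etrans (esym (dt_line g 0 x))).
have gc' : \forall t \near (0 : R),
    (fun r : R => g (r, x)) t = (c *: (id : R -> R^o)) t by exact: gc.
transitivity ('D_1 (c *: (id : R -> R^o)) (0 : R)); first exact: near_eq_derive.
have did : derivable (id : R -> R^o) (0 : R) 1 by exact: derivable_id.
by apply: (etrans (deriveZ c did)); rewrite (derive_id (0 : R^o) 1); exact: mulr1.
Qed.

Lemma partial_slice k g t (x : X) : partial k (fun y => g (t, y)) x = dx k g (t, x).
Proof. exact: derive_slice. Qed.

Lemma lap_slice g t (x : X) :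
  lap (fun y => g (t, y)) x = \sum_k dx k (dx k g) (t, x).
Proof.
apply: eq_bigr => k _; rewrite -partial_slice; congr (partial k _ x).
by apply/funext => y; exact: partial_slice.
Qed.

Lemma partial_ext (A : set X) (f g : X -> R) k x : open A -> A x ->
  (forall y, A y -> f y = g y) -> partial k f x = partial k g x.
Proof. exact: (@derive_ext R X R^o). Qed.

Lemma lap_ext (A : set X) (f g : X -> R) x : open A -> A x ->
  (forall y, A y -> f y = g y) -> lap f x = lap g x.
Proof.
move=> Ao Ax fg; apply: eq_bigr => k _; apply: (partial_ext _ Ao Ax) => y Ay.
exact: partial_ext fg.
Qed.

Lemma dt_dx U g k p : open U -> U p -> Ck 2 U g -> dt (dx k g) p = dx k (dt g) p.
Proof. exact: Schwarz. Qed.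

Lemma dt_dx_dx U g k p : open U -> U p -> Ck 3 U g ->
  dt (dx k (dx k g)) p = dx k (dx k (dt g)) p.
Proof.
move=> Uo Up gk; apply: (etrans (dt_dx k Uo Up (Ck_dx k gk))).
by apply: (derive_ext _ Uo Up) => q Uq; exact: dt_dx Uo Uq (Ck_weak gk).
Qed.

Lemma dt_coord U (v : TX -> X) k p : Ck 1 U v -> U p ->
  (dt v p) 0 k = dt (fun q => v q 0 k : R^o) p.
Proof.
move=> vk Up; rewrite /dt derive_mx ?mxE//.
exact/diff_derivable/(Ck_diff vk Up).
Qed.

End SpaceTimeReal.

(** * The linearized system *)

Lemma Mpot_log_activity (R : realType) (N d : nat) (P : params R N)
    (S : state R N d) j x : 0 < conc S j x ->
  Mpot P S j x = log_activity P (conc_at S x) j + zR P j * pot S x.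
Proof.
move=> n0; have g0 : 0 < act_coef P (conc_at S x) j by exact: expR_gt0.
by rewrite /Mpot lnM ?posrE ?expR_gt0 ?mulr_gt0// expRK.
Qed.

Lemma closure_fluid_region (R : realType) (d : nat) (D : geometry R d) x :
  closure (fluid D) x -> fluid_region D x.
Proof.
move=> Dx; exists (fun=> 0); rewrite (_ : \row__ _ = 0) ?addr0//.
by apply/rowP => k; rewrite !mxE mul0r.
Qed.

Lemma fluid_fluid_region (R : realType) (d : nat) (D : geometry R d) x :
  fluid D x -> fluid_region D x.
Proof. by move=> Dx; apply: closure_fluid_region; exact: subset_closure. Qed.

Lemma fluid_region_shift (R : realType) (d : nat) (D : geometry R d) x k :
  fluid_region D x -> fluid_region D (x + len D k *: (delta_mx 0 k : 'rV[R]_d)).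
Proof.
move=> [m Dx]; exists (fun l => m l - (l == k)%:Z).
rewrite (_ : _ + _ + _ = x + \row_l ((m l)%:~R * len D l))//.
apply/rowP => l; rewrite !mxE eqxx /= -addrA; congr (_ + _).
rewrite intrB mulrBl; case: eqVneq => [->|_]; rewrite ?mulr1 ?mul1r ?mulr0 ?mul0r.
  by rewrite addrC subrK.
by rewrite subr0 add0r.
Qed.

Lemma solid_boundary_closure (R : realType) (d : nat) (D : geometry R d) x :
  solid_boundary D x -> closure (fluid D) x.
Proof. by move=> [[]]. Qed.

Section Linearization.
Context {R : realType} {N d : nat} {P : params R N} {D : geometry R d}.
Context {f : 'rV[R]_d -> 'rV[R]_d} {Sigma Psiext : 'rV[R]_d -> R}.
Context {ninf ginf : 'I_N -> R} {S0 : state R N d} {S : R -> state R N d}.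
Context {Phi : R -> 'I_N -> 'rV[R]_d -> R} {s : R}.
Notation X := 'rV[R]_d.
Notation TX := (R^o * X)%type.

Hypotheses (hP : wf_params P) (hD : wf_geometry D).
Hypothesis hs : forall k, sigma P k = s.
Hypothesis hS0 : equilibrium P D Sigma ninf ginf S0.
Hypothesis hS_init : S 0 = S0.
Hypothesis hS : \forall t \near (0 : R),
  ek_solution P D (fun x => t *: f x) Sigma (fun x => t * Psiext x) (S t).
Hypothesis hPhi : \forall t \near (0 : R),
  ionic_potential P ninf ginf (fun x => t * Psiext x) (S t) (Phi t).

(** All fields are taken jointly in [(t, x)], since the time and space
    derivatives have to be exchanged. *)
Let Vel : TX -> X := fun tx => vel (S tx.1) tx.2.
Let V k : TX -> R^o := fun tx => vel (S tx.1) tx.2 0 k.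
Let Pre : TX -> R^o := fun tx => pres (S tx.1) tx.2.
Let Psi : TX -> R^o := fun tx => pot (S tx.1) tx.2.
Let C j : TX -> R^o := fun tx => conc (S tx.1) j tx.2.
Let M j : TX -> R^o := fun tx => Mpot P (S tx.1) j tx.2.
Let L j : TX -> R^o := fun tx => log_activity P (fun i => C i tx) j.
Let K i j : TX -> R^o := fun tx => Kmat P (fun l => C l tx) i j.

Variable O : set TX.
Hypotheses (Oo : open O) (OF : [set 0] `*` fluid_region D `<=` O).
Hypotheses (Velk : Ck 3 O Vel) (Prek : Ck 2 O Pre) (Psik : Ck 3 O Psi).
Hypothesis Ck_C : forall j, Ck 3 O (C j).
Hypothesis C_gt0 : forall j tx, O tx -> 0 < C j tx.
Hypothesis xi_lt1 : forall tx, O tx -> xi P (fun i => C i tx) < 1.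

Let O0 := [set x : X | O (0, x)].
Let O0_open : open O0. Proof. exact: open_slice. Qed.
Let O0_F x : fluid_region D x -> O0 x. Proof. by move=> Fx; apply: OF. Qed.

Let Vk k : Ck 3 O (V k). Proof. exact: Ck_coord Velk. Qed.
Let Lk j : Ck 3 O (L j).
Proof. exact: (Ck_log_activity hP hs). Qed.
Let Kk i j : Ck 3 O (K i j). Proof. exact: (Ck_Kmat hP hs). Qed.

Let ME j tx : O tx -> M j tx = L j tx + zR P j * Psi tx.
Proof. by move=> Otx; exact/Mpot_log_activity/C_gt0. Qed.

Let Mk j : Ck 3 O (M j).
Proof.
apply: (Ck_ext Oo (f := fun tx => L j tx + zR P j * Psi tx)).
  by move=> tx Otx; rewrite ME.
exact: (Ck_add Oo (Lk j) (Ck_mul Oo (Ck_cst 3 O (zR P j : R^o)) Psik)).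
Qed.

Let diffC1 m (g : TX -> R^o) p : Ck m.+1 O g -> O p -> differentiable g p.
Proof. exact: Ck_diff. Qed.

Let M_derive j v p : O p -> 'D_v (M j) p = 'D_v (L j) p + zR P j * 'D_v Psi p.
Proof.
move=> Op; have dL := diffC1 (Lk j) Op; have dPsi := diffC1 Psik Op.
rewrite -derive_mull// -derive_add//; last exact: differentiableZ.
by apply: (derive_ext _ Oo Op) => q Oq; exact: ME.
Qed.

(** Continuity of the gradient carries the equilibrium condition from the fluid
    to its boundary, where the no-flux condition is stated. *)
Let dx_M0 j k x : closure (fluid D) x -> dx k (M j) (0, x) = 0.
Proof.
move=> Dx; have [_ _ gM0 _ _ _] := hS0.
pose g y : R^o := dx k (M j) (0, y).
have g0 y : fluid D y -> g y = 0.
  move=> /(gM0 j) /(congr1 (fun v : X => v 0 k)); rewrite !mxE -hS_init => gk.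
  by rewrite /g -partial_slice; exact: gk.
have gk : Ck 0 O0 (g : X -> R^o) by exact: (Ck_le (leq0n 2) (Ck_slice 0 (Ck_dx k (Mk j)))).
have gc : {for x, continuous (g : X -> R^o)} by apply: gk; exact/O0_F/closure_fluid_region.
apply: contrapT => gx; have gx0 : 0 < `|g x| by rewrite normr_gt0; apply/eqP.
have /cvgrPdist_lt/(_ _ gx0) near_x := gc.
have [y [/g0 gy]] := Dx _ near_x.
by rewrite /= gy subr0 ltxx.
Qed.

Let u : X -> X := first_variation (fun t => vel (S t)).
Let dp : X -> R := @first_variation R d R^o (fun t => pres (S t)).
Let dPsi : X -> R := @first_variation R d R^o (fun t => pot (S t)).
Let dPhi j : X -> R := @first_variation R d R^o (fun t => Phi t j).
Let Pr : X -> R := fun x =>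
  dp x + \sum_j zR P j * conc S0 j x * (dPsi x + dPhi j x + Psiext x).

Let uE x : u x = dt Vel (0, x). Proof. exact: first_variation_dt. Qed.
Let dpE x : dp x = dt Pre (0, x). Proof. exact: (@first_variation_dt _ _ R^o). Qed.
Let dPsiE x : dPsi x = dt Psi (0, x).
Proof. exact: (@first_variation_dt _ _ R^o). Qed.

Let u_coord x k : O0 x -> u x 0 k = dt (V k) (0, x).
Proof. by move=> Ox; rewrite uE; apply: (dt_coord _ _ Ox); exact: Ck_le Velk. Qed.

Let C0E j x : C j (0, x) = conc S0 j x. Proof. by rewrite -hS_init. Qed.

Let near_C_gt0 x : O0 x -> \forall t \near (0 : R), forall j, 0 < C j (t, x).
Proof.
move=> Ox; have : \forall t \near (0 : R), O (t, x).
  have := @time_slice_continuous R d 0 x O; apply; exact: open_nbhs_nbhs.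
by apply: filterS => t Ot j; exact: C_gt0.
Qed.

(** By definition of the ionic potentials,
    [M_j = ln (ninf_j ginf_j) - z_j (Phi_j + t Psiext)]. *)
Let dPhiE j x : O0 x -> dPhi j x + Psiext x = - (zR P j)^-1 * dt (M j) (0, x).
Proof.
move=> Ox; have zn0 := zR_neq0 hP j; have [_ _ _ ni0 gi0 _] := hS0.
pose c := ln (ninf j * ginf j).
have PhiE : \forall t \near (0 : R),
    Phi t j x = (zR P j)^-1 * c + - (zR P j)^-1 * M j (t, x) - Psiext x * t.
  near=> t; have ion : ionic_potential P ninf ginf (fun x => t * Psiext x) (S t) (Phi t).
    by near: t.
  have n0 : forall i, 0 < conc (S t) i x by near: t; exact: near_C_gt0.
  rewrite /M /Mpot /= (ion j x n0) -mulrA -expRD lnM ?posrE ?expR_gt0 ?mulr_gt0//.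
  by rewrite expRK /c; field.
rewrite /dPhi /first_variation derive1E (near_eq_derive _ PhiE).
have dM : derivable (fun t : R => M j (t, x)) 0 1.
  exact/derivable_line/(diffC1 (Mk j)).
by apply: etrans (congr1 (+%R^~ _) (derive_affine _ _ _ dM)) _; rewrite dt_line subrK.
Unshelve. all: by end_near. Qed.

Let dt_M j p : O p -> dt (M j) p = dt (L j) p + zR P j * dt Psi p.
Proof. exact: M_derive. Qed.

(** The variation of [- z_j^-1 L_j]: the electrostatic potential cancels. *)
Let dpotE j x : O0 x ->
  dPsi x + dPhi j x + Psiext x = - (zR P j)^-1 * dt (L j) (0, x).
Proof.
move=> Ox; have zn0 := zR_neq0 hP j.
rewrite -addrA (dPhiE j Ox) dPsiE (dt_M j Ox).
by move: (dt (L j) _) (dt Psi _) => a b; field.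
Qed.

Let PrE x : O0 x -> Pr x = dt Pre (0, x) - \sum_j C j (0, x) * dt (L j) (0, x).
Proof.
move=> Ox; rewrite /Pr dpE -sumrN; apply: (eq_add (erefl _)).
apply: eq_bigr => j _; have zn0 := zR_neq0 hP j.
rewrite (dpotE j Ox) -C0E; move: (dt (L j) _) (C j _) => a b; by field.
Qed.

Let ddPhik j : Ck 2 O0 ((fun x => dPhi j x + Psiext x) : X -> R^o).
Proof.
apply: (Ck_ext O0_open (f := fun x => - (zR P j)^-1 * dt (M j) (0, x))).
  by move=> x Ox; rewrite dPhiE.
apply: (Ck_mul O0_open); first exact: Ck_cst.
exact: (Ck_slice 0 (Ck_dt (Mk j))).
Qed.

Let partial_dPhi j k x : O0 x ->
  partial k (fun y => dPhi j y + Psiext y) x = - (zR P j)^-1 * dx k (dt (M j)) (0, x).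
Proof.
move=> Ox; rewrite -partial_slice -derive_mull.
  by apply: (partial_ext _ O0_open Ox) => y Oy; exact: dPhiE.
exact: (Ck_diff (Ck_slice 0 (Ck_dt (Mk j)))).
Qed.

Let vel_reg : Ck_near 2 (fluid_region D) u.
Proof.
exists O0; split=> //; apply: (Ck_ext O0_open) (Ck_slice 0 (Ck_dt Velk)) => x _.
by rewrite uE.
Qed.

Let sumk m (A : set X) (g : 'I_N -> X -> R^o) : open A ->
  (forall j, Ck m A (g j)) -> Ck m A ((fun x => \sum_j g j x) : X -> R^o).
Proof. by move=> Ao gk; exact: Ck_sum. Qed.

Let Lt_k j : Ck 2 O0 (fun x => dt (L j) (0, x)).
Proof. exact: (Ck_slice 0 (Ck_dt (Lk j))). Qed.

Let C0k j : Ck 3 O0 (fun x => C j (0, x)).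
Proof. exact: (Ck_slice 0 (Ck_C j)). Qed.

Let CLk j : Ck 2 O0 ((fun x => C j (0, x) * dt (L j) (0, x)) : X -> R^o).
Proof. exact: (Ck_mul O0_open (Ck_weak (C0k j)) (Lt_k j)). Qed.

Let pres_reg : Ck_near 1 (fluid_region D) (Pr : X -> R^o).
Proof.
exists O0; split=> //.
apply: (Ck_ext O0_open
  (f := fun x => dt Pre (0, x) - \sum_j C j (0, x) * dt (L j) (0, x))).
  by move=> x Ox; rewrite PrE.
apply: (Ck_add O0_open (Ck_slice 0 (Ck_dt Prek))); apply: (Ck_opp O0_open).
by apply: (sumk O0_open) => j; exact: (Ck_weak (CLk j)).
Qed.

Let partial_Pr k x : O0 x -> partial k Pr x = dx k (dt Pre) (0, x) -
  \sum_j (dx k (C j) (0, x) * dt (L j) (0, x) + C j (0, x) * dx k (dt (L j)) (0, x)).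
Proof.
move=> Ox.
have dC j : differentiable (fun y : X => C j (0, y)) x by exact: Ck_diff (C0k j) Ox.
have dL j : differentiable (fun y : X => dt (L j) (0, y)) x.
  exact: Ck_diff (Lt_k j) Ox.
have dCL j : differentiable (fun y : X => C j (0, y) * dt (L j) (0, y) : R^o) x.
  exact: Ck_diff (CLk j) Ox.
have dP : differentiable (fun y : X => dt Pre (0, y)) x.
  exact: Ck_diff (Ck_slice 0 (Ck_dt Prek)) Ox.
have dS : differentiable (fun y : X => \sum_j C j (0, y) * dt (L j) (0, y) : R^o) x.
  by apply: (Ck_diff (sumk O0_open CLk)).
apply: etrans (partial_ext k O0_open Ox PrE) _.
apply: (etrans (derive_sub _ dP dS));
  apply: (eq_sub (partial_slice k (dt Pre) 0 x)).
apply: (etrans (derive_bigsum _ dCL)); apply: eq_bigr => j _.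
apply: (etrans (derive_mul _ (dC j) (dL j))); exact: (eq_add (eq_mul (partial_slice k (C j) 0 x) (erefl _))
  (eq_mul (erefl _) (partial_slice k (dt (L j)) 0 x))).
Qed.

Let div_u x : O0 x -> div u x = \sum_k dx k (dt (V k)) (0, x).
Proof.
move=> Ox; apply: eq_bigr => k _; rewrite -partial_slice.
by apply: (partial_ext _ O0_open Ox) => y Oy; exact: u_coord.
Qed.

Let dt_bigsum m (g : 'I_m -> TX -> R^o) p :
  (forall i, differentiable (g i) p) ->
  dt (fun q => \sum_i g i q : R^o) p = \sum_i dt (g i) p.
Proof. exact: derive_bigsum. Qed.

Let incompressible x : fluid D x -> div u x = 0.
Proof.
move=> Dx; have Ox : O0 x by exact/O0_F/fluid_fluid_region.
rewrite div_u//.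
transitivity (dt (fun p => \sum_k dx k (V k) p : R^o) (0, x)).
  rewrite dt_bigsum; last by move=> k; exact: (Ck_diff (Ck_dx k (Vk k)) Ox).
  by apply: eq_bigr => k _; rewrite (dt_dx _ Oo Ox (Ck_weak (Vk k))).
apply: near_dt_linear; near=> t; have Ht : ek_solution P D (fun x => t *: f x) Sigma (fun x => t * Psiext x) (S t).
  by near: t.
rewrite mul0r -[RHS](ek_incompressible Ht Dx); apply: eq_bigr => k _.
exact/esym/partial_slice.
Unshelve. all: by end_near. Qed.

Let noslip x : solid_boundary D x -> u x = 0.
Proof.
move=> Bx; rewrite /u /first_variation derive1E.
have E : \forall t \near (0 : R), vel (S t) x = cst 0 t.
  by apply: filterS hS => t Ht; exact: (ek_noslip Ht).
by rewrite (near_eq_derive _ E) derive_cst.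
Qed.

(** The [t]-derivative at [0] of the momentum equation along the family. *)
Let momentum_eq k x : fluid D x ->
  eps P ^+ 2 * \sum_l dx l (dx l (dt (V k))) (0, x) - dx k (dt Pre) (0, x) =
  f x 0 k + \sum_j zR P j * (dt (C j) (0, x) * dx k Psi (0, x)
                             + C j (0, x) * dx k (dt Psi) (0, x)).
Proof.
move=> Dx; have Ox : O0 x by exact/O0_F/fluid_fluid_region.
have dVll l : differentiable (dx l (dx l (V k))) (0, x).
  exact: (Ck_diff (Ck_dx l (Ck_dx l (Vk k))) Ox).
have dVs : differentiable (fun p => \sum_l dx l (dx l (V k)) p : R^o) (0, x).
  by apply: (Ck_diff (k := 0) (Ck_sum _ Oo _) Ox) => l; exact: (Ck_dx l (Ck_dx l (Vk k))).
have dPk : differentiable (dx k Pre) (0, x) by exact: (Ck_diff (Ck_dx k Prek) Ox).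
have dPsik : differentiable (dx k Psi) (0, x) by exact: (Ck_diff (Ck_dx k Psik) Ox).
have dC j : differentiable (C j) (0, x) by exact: (Ck_diff (Ck_C j) Ox).
have dCP j : differentiable (fun p => C j p * dx k Psi p : R^o) (0, x).
  exact: differentiableM.
have dzCP j : differentiable (fun p => zR P j * (C j p * dx k Psi p) : R^o) (0, x).
  exact: differentiableZ.
have dR : differentiable
    (fun p => \sum_j zR P j * (C j p * dx k Psi p) : R^o) (0, x).
  apply: (Ck_diff (k := 0) (Ck_sum _ Oo _) Ox) => j.
  apply: (Ck_mul Oo (Ck_cst 1 O (zR P j : R^o))); apply: (Ck_mul Oo).
    exact: (Ck_le _ (Ck_C j)).
  exact: (Ck_weak (Ck_dx k Psik)).
pose lhs p : R^o := eps P ^+ 2 * (\sum_l dx l (dx l (V k)) p) - dx k Pre p.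
pose rhs p : R^o := \sum_j zR P j * (C j p * dx k Psi p).
have dlhs : differentiable lhs (0, x).
  exact: (differentiableB (differentiableZ _ dVs) dPk).
have lhsE : dt lhs (0, x) =
    eps P ^+ 2 * \sum_l dx l (dx l (dt (V k))) (0, x) - dx k (dt Pre) (0, x).
  apply: (etrans (derive_sub _ (differentiableZ _ dVs) dPk)).
  apply: (eq_sub _ (dt_dx _ Oo Ox Prek)).
  apply: (etrans (derive_mull _ _ dVs)); apply: (eq_mul (erefl _)).
  apply: (etrans (derive_bigsum _ dVll)); apply: eq_bigr => l _.
  exact: (dt_dx_dx _ Oo Ox (Vk k)).
have rhsE : dt rhs (0, x) = \sum_j zR P j * (dt (C j) (0, x) * dx k Psi (0, x)
                             + C j (0, x) * dx k (dt Psi) (0, x)).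
  apply: (etrans (derive_bigsum _ dzCP)); apply: eq_bigr => j _.
  apply: (etrans (derive_mull _ _ (dCP j))); apply: (eq_mul (erefl _)).
  apply: (etrans (derive_mul _ (dC j) dPsik)).
  exact: (eq_add (erefl _) (eq_mul (erefl _) (dt_dx _ Oo Ox (Ck_weak Psik)))).
rewrite -lhsE -rhsE; apply/eqP; rewrite -subr_eq; apply/eqP.
apply: (etrans (esym (derive_sub _ dlhs dR))); apply: near_dt_linear.
near=> t; have Ht : ek_solution P D (fun x => t *: f x) Sigma (fun x => t * Psiext x) (S t).
  by near: t.
have := congr1 (fun v : X => v 0 k) (ek_momentum Ht Dx).
rewrite !mxE summxE => E.
have {}E : eps P ^+ 2 * lap (fun y => V k (t, y)) x - partial k (fun y => Pre (t, y)) x =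
  t * f x 0 k + \sum_j (zR P j * C j (t, x)) * partial k (fun y => Psi (t, y)) x.
  by rewrite E; congr (_ + _); apply: eq_bigr => j _; rewrite !mxE.
rewrite lap_slice !partial_slice in E; rewrite /lhs E mulrC -addrA -[RHS]addr0.
apply: (eq_add (erefl _)); apply/eqP; rewrite subr_eq0; apply/eqP.
by apply: eq_bigr => j _; rewrite -mulrA.
Unshelve. all: by end_near. Qed.

(** The equilibrium relation [grad M_j = 0] turns the variation of the
    electric force into
    [- sum_j (dt C_j) grad L_j], which by the symmetry of the thermodynamic
    coefficients is [- sum_j (grad C_j) (dt L_j)]. *)
Let force_symmetry k x : fluid D x ->
  \sum_j zR P j * (dt (C j) (0, x) * dx k Psi (0, x)) =
  - \sum_j dx k (C j) (0, x) * dt (L j) (0, x).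
Proof.
move=> Dx; have Ox : O0 x by exact/O0_F/fluid_fluid_region.
have zPsi j : zR P j * dx k Psi (0, x) = - dx k (L j) (0, x).
  apply/eqP; rewrite -addr_eq0 addrC -(M_derive j (0, delta_mx 0 k) Ox).
  by apply/eqP; exact: (dx_M0 j k (subset_closure Dx)).
transitivity (- \sum_j dt (C j) (0, x) * dx k (L j) (0, x)).
  by rewrite -sumrN; apply: eq_bigr => j _; rewrite mulrCA zPsi mulrN.
have C1 j : Ck 1 O (C j) by exact: (Ck_le (isT : (1 <= 3)%N) (Ck_C j)).
exact: (congr1 -%R (@log_activity_symmetry _ _ _ _ hP hs _ _ _ Oo C1 C_gt0 xi_lt1
  (0, x) (1, 0) (0, delta_mx 0 k) Ox)).
Qed.

Let partial_dPhi_L j k x : O0 x ->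
  partial k (fun y => dPhi j y + Psiext y) x =
  - (zR P j)^-1 * (dx k (dt (L j)) (0, x) + zR P j * dx k (dt Psi) (0, x)).
Proof.
move=> Ox; have dLt : differentiable (dt (L j)) (0, x).
  exact: (Ck_diff (Ck_dt (Lk j)) Ox).
have dPt : differentiable (dt Psi) (0, x) by exact: (Ck_diff (Ck_dt Psik) Ox).
apply: (etrans (partial_dPhi j k Ox)); apply: (eq_mul (erefl _)).
apply: (etrans (derive_ext _ Oo Ox (fun q Oq => dt_M j Oq))).
apply: (etrans (derive_add _ dLt (differentiableZ _ dPt))).
exact: (eq_add (erefl _) (derive_mull _ _ dPt)).
Qed.

Let momentum x : fluid D x ->
  eps P ^+ 2 *: vlap u x - grad Pr x =
  f x - \sum_j (zR P j * conc S0 j x) *: grad (fun y => dPhi j y + Psiext y) x.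
Proof.
move=> Dx; have Ox : O0 x by exact/O0_F/fluid_fluid_region.
apply/rowP => k; rewrite !mxE summxE.
have -> : lap (fun y => u y 0 k) x = \sum_l dx l (dx l (dt (V k))) (0, x).
  rewrite -lap_slice; apply: (lap_ext O0_open Ox) => y Oy; exact: u_coord.
rewrite partial_Pr// opprB addrCA addrC momentum_eq// -addrA; apply: (eq_add (erefl _)).
rewrite !big_split /=.
under eq_bigr do rewrite mulrDr.
rewrite big_split /= force_symmetry// addrACA addNr add0r -big_split -sumrN /=.
apply: eq_bigr => j _; rewrite !mxE (partial_dPhi_L j k Ox) -C0E.
have zn0 := zR_neq0 hP j.
by move: (dx k (dt (L j)) _) (dx k (dt Psi) _) (C j _) => a b c; field.
Qed.

(** The components of [- j_i]; at equilibrium the gradient factor vanishes, so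
    that only that factor needs to be varied. *)
Let J i k : TX -> R^o := fun p => \sum_j (C i p * K i j p) * dx k (M j) p.

Let CKk i j : Ck 3 O (fun p => C i p * K i j p : R^o).
Proof. exact: (Ck_mul Oo (Ck_C i) (Kk i j)). Qed.

Let CKMk i j k : Ck 2 O (fun p => C i p * K i j p * dx k (M j) p : R^o).
Proof. exact: (Ck_mul Oo (Ck_weak (CKk i j)) (Ck_dx k (Mk j))). Qed.

Let Jk i k : Ck 2 O (J i k).
Proof. by apply: (Ck_sum _ Oo) => j; exact: CKMk. Qed.

Let flux_slice i k t y : flux P (S t) i y 0 k = - J i k (t, y).
Proof.
rewrite /flux mxE summxE; congr (- _); apply: eq_bigr => j _; rewrite !mxE.
by apply: (eq_mul (erefl _)); exact: partial_slice.
Qed.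

Let dt_J i k y : closure (fluid D) y ->
  dt (J i k) (0, y) =
  - (conc S0 i y * \sum_j (Kmat P (fun l => conc S0 l y) i j * zR P j)
                  * partial k (fun y' => dPhi j y' + Psiext y') y).
Proof.
move=> Dy; have Oy : O0 y by exact/O0_F/closure_fluid_region.
apply: (etrans (derive_bigsum _ (fun j => Ck_diff (CKMk i j k) Oy))).
rewrite mulr_sumr -sumrN; apply: eq_bigr => j _.
have dCK : differentiable (fun p => C i p * K i j p : R^o) (0, y).
  exact: (Ck_diff (CKk i j) Oy).
have dM : differentiable (dx k (M j)) (0, y) by exact: (Ck_diff (Ck_dx k (Mk j)) Oy).
apply: (etrans (derive_mul _ dCK dM)); rewrite dx_M0// mulr0 add0r.
rewrite partial_dPhi//.
have -> : 'D_(1, 0) (dx k (M j)) (0, y) = dx k (dt (M j)) (0, y).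
  exact: (dt_dx _ Oo Oy (Ck_weak (Mk j))).
have -> : K i j (0, y) = Kmat P (fun l => conc S0 l y) i j by rewrite -hS_init.
rewrite C0E; have zn0 := zR_neq0 hP j.
by move: (dx k (dt (M j)) _) (Kmat _ _ _ _) (conc _ _ _) => a b c; field.
Qed.

(** The components of [j_i + Pe_i n_i u]. *)
Let T i k : TX -> R^o := fun p => Pe P i * (C i p * V k p) - J i k p.

Let CVk i k : Ck 3 O (fun p => C i p * V k p : R^o).
Proof. exact: (Ck_mul Oo (Ck_C i) (Vk k)). Qed.

Let Tk i k : Ck 2 O (T i k).
Proof.
apply: (Ck_add Oo); last exact: (Ck_opp Oo (Jk i k)).
exact: (Ck_mul Oo (Ck_cst 2 O (Pe P i : R^o)) (Ck_weak (CVk i k))).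
Qed.

(** The velocity vanishes at equilibrium, so the convective term is varied
    through the velocity alone. *)
Let dt_T i k y : fluid D y ->
  dt (T i k) (0, y) =
  (conc S0 i y *: (\sum_j (Kmat P (fun l => conc S0 l y) i j * zR P j)
                  *: grad (fun y' => dPhi j y' + Psiext y') y
                + Pe P i *: u y)) 0 k.
Proof.
move=> Dy; have Oy : O0 y by exact/O0_F/fluid_fluid_region.
have dC : differentiable (C i) (0, y) by exact: (Ck_diff (Ck_C i) Oy).
have dV : differentiable (V k) (0, y) by exact: (Ck_diff (Vk k) Oy).
have dCV : differentiable (fun p => C i p * V k p : R^o) (0, y).
  exact: (Ck_diff (CVk i k) Oy).
have dJ : differentiable (J i k) (0, y) by exact: (Ck_diff (Jk i k) Oy).
have V0 : V k (0, y) = 0.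
  have [_ v0 _ _ _ _] := hS0.
  by rewrite /V /= hS_init v0 ?mxE//; exact: fluid_fluid_region.
have TE : dt (T i k) (0, y) = Pe P i * (C i (0, y) * dt (V k) (0, y)) - dt (J i k) (0, y).
  apply: (etrans (derive_sub _ (differentiableZ _ dCV) dJ)).
  apply: (eq_sub _ (erefl _)).
  apply: (etrans (derive_mull _ _ dCV)); apply: (eq_mul (erefl _)).
  apply: (etrans (derive_mul _ dC dV)); rewrite V0 mulr0 add0r.
  exact: erefl.
rewrite TE dt_J ?C0E; last exact: subset_closure.
rewrite opprK !mxE u_coord// summxE.
under [in RHS]eq_bigr do rewrite !mxE.
by rewrite mulrDr addrC mulrCA.
Qed.

Let transport i x : fluid D x ->
  div (fun y => conc S0 i y *:
         (\sum_j (Kmat P (fun k => conc S0 k y) i j * zR P j)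
                   *: grad (fun y' => dPhi j y' + Psiext y') y
          + Pe P i *: u y)) x = 0.
Proof.
move=> Dx; have Ox : O0 x by exact/O0_F/fluid_fluid_region.
transitivity (\sum_k dx k (dt (T i k)) (0, x)).
  apply: eq_bigr => k _; rewrite -partial_slice.
  by apply: (partial_ext k (fluid_open hD) Dx) => y Dy; rewrite dt_T.
transitivity (dt (fun p => \sum_k dx k (T i k) p : R^o) (0, x)).
  rewrite dt_bigsum; last by move=> k; exact: (Ck_diff (Ck_dx k (Tk i k)) Ox).
  by apply: eq_bigr => k _; rewrite (dt_dx _ Oo Ox (Tk i k)).
apply: near_dt_linear; near=> t.
have Ht : ek_solution P D (fun x => t *: f x) Sigma (fun x => t * Psiext x) (S t).
  by near: t.
rewrite mul0r -[RHS](ek_transport Ht i Dx); apply: eq_bigr => k _.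
rewrite -partial_slice; congr (partial k _ x); apply/funext => y.
by rewrite [RHS]mxE flux_slice [X in _ = _ + X]mxE [RHS]addrC -mulrA.
Unshelve. all: by end_near. Qed.

Let noflux i x : solid_boundary D x ->
  dot (\sum_j (Kmat P (fun k => conc S0 k x) i j * zR P j)
                *: grad (fun y => dPhi j y + Psiext y) x) (normal D x) = 0.
Proof.
move=> Bx; have Dx := solid_boundary_closure Bx.
have Fx := closure_fluid_region Dx; have Ox := O0_F Fx.
have dJ k : differentiable (J i k) (0, x) by exact: (Ck_diff (Jk i k) Ox).
have dJn k : differentiable (fun p => normal D x 0 k * J i k p : R^o) (0, x).
  exact: (differentiableZ _ (dJ k)).
have J0 : dt (fun p => \sum_k normal D x 0 k * J i k p : R^o) (0, x) = 0.
  apply: near_dt_linear; near=> t.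
  have Ht : ek_solution P D (fun x => t *: f x) Sigma (fun x => t * Psiext x) (S t).
    by near: t.
  rewrite mul0r; apply: oppr_inj; rewrite oppr0 -[RHS](ek_noflux Ht i Bx).
  rewrite -sumrN; apply: eq_bigr => k _.
  by rewrite flux_slice mulrC mulNr.
have n0 : conc S0 i x != 0.
  by rewrite -C0E gt_eqF//; exact: C_gt0.
apply: (mulfI n0); apply: oppr_inj; rewrite mulr0 oppr0 -[RHS]J0.
rewrite mulr_sumr -sumrN; apply: esym; apply: (etrans (derive_bigsum _ dJn)).
apply: eq_bigr => k _; apply: (etrans (derive_mull _ _ (dJ k))).
apply: (etrans (eq_mul (erefl _) (dt_J i k Dx))).
rewrite summxE mulrN mulrC -mulrA; congr (- (_ * (_ * _))).
by apply: eq_bigr => j _; rewrite !mxE.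
Unshelve. all: by end_near. Qed.

Notation shift k x := (x + len D k *: (delta_mx 0 k : X)).

Let variation_periodic (W : normedModType R) (g : R -> X -> W) :
  (\forall t \near (0 : R), box_periodic D (g t)) ->
  box_periodic D (first_variation g).
Proof.
move=> gper x k Fx; rewrite /first_variation !derive1E; apply: near_eq_derive.
by apply: filterS gper => t; apply.
Qed.

Let vel_per : box_periodic D u.
Proof. by apply: variation_periodic; apply: filterS hS => t; exact: ek_vel_per. Qed.

(** The relation defining the ionic potentials expresses
    [Psi + Phi_j + t Psiext] through the concentrations, which are periodic;
    with the periodicity of [Psi + t Psiext] this makes [Phi_j] periodic. *)
Let activity_periodic : \forall t \near (0 : R), forall j x k, fluid_region D x ->
  pot (S t) (shift k x) + Phi t j (shift k x) + t * Psiext (shift k x) =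
  pot (S t) x + Phi t j x + t * Psiext x.
Proof.
near=> t => j x k Fx.
have ion : ionic_potential P ninf ginf (fun x => t * Psiext x) (S t) (Phi t) by near: t.
have Ht : ek_solution P D (fun x => t *: f x) Sigma (fun x => t * Psiext x) (S t).
  by near: t.
have Fkx := fluid_region_shift k Fx; have [_ _ _ ni0 gi0 _] := hS0.
have nE : conc_at (S t) (shift k x) = conc_at (S t) x.
  by apply/funext => l; exact: (ek_conc_per Ht).
have := ion j (shift k x) (fun l => ek_conc_gt0 Ht l Fkx).
rewrite nE (ek_conc_per Ht j k Fx) (ion j x (fun l => ek_conc_gt0 Ht l Fx)).
move=> /(mulfI _)/expR_inj/oppr_inj/(mulfI (zR_neq0 hP j)) -> //.
by rewrite mulf_neq0// gt_eqF.
Unshelve. all: by end_near. Qed.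

Let Phi_per j : box_periodic D (dPhi j).
Proof.
apply: (@variation_periodic R^o (fun t => Phi t j)); near=> t => x k Fx.
have Ht : ek_solution P D (fun x => t *: f x) Sigma (fun x => t * Psiext x) (S t).
  by near: t.
have : pot (S t) (shift k x) + Phi t j (shift k x) + t * Psiext (shift k x) =
    pot (S t) x + Phi t j x + t * Psiext x.
  have H := near activity_periodic t; exact: H.
have := ek_pot_per Ht k Fx; rewrite /= => E1 E2.
move: E2; rewrite addrAC E1 [RHS]addrAC; exact: addrI.
Unshelve. all: by end_near. Qed.

Let pres_per : box_periodic D Pr.
Proof.
move=> x k Fx; have Fkx := fluid_region_shift k Fx.
have Ox := O0_F Fx; have Okx := O0_F Fkx.
have dp_per : box_periodic D dp.
  apply: (@variation_periodic R^o (fun t => pres (S t))).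
  by apply: filterS hS => t; exact: ek_pres_per.
have [sol0 _ _ _ _ _] := hS0.
rewrite /Pr (dp_per _ _ Fx); congr (_ + _); apply: eq_bigr => j _.
rewrite (ek_conc_per sol0 j k Fx); congr (_ * _).
have L_per : dt (L j) (0, shift k x) = dt (L j) (0, x).
  rewrite -!dt_line; apply: near_eq_derive.
  apply: filterS hS => t Ht; rewrite /L; congr (log_activity _ _ _).
  by apply/funext => l; exact: (ek_conc_per Ht).
by rewrite (dpotE j Ox) (dpotE j Okx) L_per.
Qed.

Lemma linearized_solution_of_domain :
  linearized_solution P D f Psiext (conc S0) u Pr dPhi.
Proof.
split.
- exact: vel_reg.
- exact: pres_reg.
- by move=> j; exists O0; split => //; exact: ddPhik.
- exact: momentum.
- exact: incompressible.
- exact: noslip.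
- exact: transport.
- exact: noflux.
- exact: vel_per.
- exact: pres_per.
- exact: Phi_per.
Qed.

End Linearization.

(** An open neighbourhood of [{0} x fluid_region] on which every field is
    regular and the thermodynamic functions are smooth; the bound on the packing
    fraction and the positivity hold at [t = 0] and persist by continuity. *)
Lemma regular_domain (R : realType) (N d : nat) (P : params R N)
    (D : geometry R d) (S : R -> state R N d) :
  smooth_family D S ->
  (forall j x, fluid_region D x -> 0 < conc (S 0) j x) ->
  (forall x, fluid_region D x -> xi P (conc_at (S 0) x) < 1) ->
  exists O : set (R^o * 'rV[R]_d), [/\ open O, [set 0] `*` fluid_region D `<=` O,
    [/\ Ck 3 O (fun tx : R^o * 'rV[R]_d => vel (S tx.1) tx.2),
        Ck 2 O ((fun tx => pres (S tx.1) tx.2) : R^o * 'rV[R]_d -> R^o),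
        Ck 3 O ((fun tx => pot (S tx.1) tx.2) : R^o * 'rV[R]_d -> R^o) &
        forall j, Ck 3 O ((fun tx => conc (S tx.1) j tx.2) : R^o * 'rV[R]_d -> R^o)],
    (forall j tx, O tx -> 0 < conc (S tx.1) j tx.2) &
    (forall tx, O tx -> xi P (fun i => conc (S tx.1) i tx.2) < 1)].
Proof.
move=> [[Uv [Uvo FUv vk]] [Up [Upo FUp pk]] [Uq [Uqo FUq qk]] ck] n_gt0 xi_lt1.
pose C j : R^o * 'rV[R]_d -> R^o := fun tx => conc (S tx.1) j tx.2.
pose Xi : R^o * 'rV[R]_d -> R^o := fun tx => xi P (fun i => C i tx).
have /choice[Uc Uck] : forall j, exists U : set (R^o * 'rV[R]_d),
    [/\ open U, [set 0] `*` fluid_region D `<=` U & Ck 3 U (C j)] by exact: ck.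
have Uco j : open (Uc j) by have [] := Uck j.
pose U := Uv `&` Up `&` Uq.
pose B := interior (U `&` [set tx | forall j, Uc j tx]).
have Bo : open B by exact: open_interior.
have Bsub : B `<=` U `&` [set tx | forall j, Uc j tx] by exact: interior_subset.
have BUc j : B `<=` Uc j by move=> tx /Bsub[_]; apply.
have FB : [set 0] `*` fluid_region D `<=` B.
  move=> tx Ftx; apply: filterI.
    by apply: filterI; [apply: filterI|]; apply: open_nbhs_nbhs; split; auto.
  apply: (@filter_forall _ _ Uc _ (nbhs_filter tx)) => j; have [_ FU _] := Uck j.
  exact: (open_in_near (Uco j) (FU _ Ftx)).
have BC j : Ck 3 B (C j) by have [_ _ Cj] := Uck j; exact: Ck_subset (BUc j) Cj.
have BXi : Ck 3 B Xi.
  apply: (Ck_mul Bo (Ck_cst 3 B (xic P : R^o))); apply: (Ck_sum _ Bo) => j.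
  exact: (Ck_mul Bo (BC j) (Ck_cst 3 B ((sigma P j / sigmac P) ^+ 3 : R^o))).
pose O := interior (B `&` [set tx | forall j, 0 < C j tx] `&` [set tx | Xi tx < 1]).
have Osub : O `<=` B `&` [set tx | forall j, 0 < C j tx] `&` [set tx | Xi tx < 1].
  exact: interior_subset.
have OB : O `<=` B by move=> tx /Osub[[]].
have BUv : B `<=` Uv by move=> tx /Bsub[[[]]].
have BUp : B `<=` Up by move=> tx /Bsub[[[]]].
have BUq : B `<=` Uq by move=> tx /Bsub[[]].
exists O; split; first exact: open_interior.
- move=> tx Ftx; have Btx := FB _ Ftx; apply: filterI; first apply: filterI.
  + exact: open_nbhs_nbhs.
  + apply: (@filter_forall _ _ (fun j tx => 0 < C j tx) _ (nbhs_filter tx)) => j.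
    have Cc : {for tx, continuous (C j)} by exact: (Ck_le (leq0n 3) (BC j)).
    have C0 : 0 < C j tx by case: tx Ftx {Btx Cc} => t x [/= -> Fx]; exact: n_gt0.
    exact: (cvgr_gt _ Cc).
  + have Xc : {for tx, continuous Xi} by exact: (Ck_le (leq0n 3) BXi).
    have X1 : Xi tx < 1 by case: tx Ftx {Btx Xc} => t x [/= -> Fx]; exact: xi_lt1.
    exact: (cvgr_lt _ Xc).
- split.
  + exact: Ck_subset (subset_trans OB BUv) vk.
  + exact: Ck_subset (subset_trans OB BUp) pk.
  + exact: Ck_subset (subset_trans OB BUq) qk.
  + by move=> j; exact: Ck_subset OB (BC j).
- by move=> j tx /Osub[[_ C0] _]; exact: C0.
- by move=> tx /Osub[_].
Qed.

Theorem proposition11 (R : realType) (N d : nat) (P : params R N)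
    (D : geometry R d) (f : 'rV[R]_d -> 'rV[R]_d)
    (Sigma Psiext : 'rV[R]_d -> R) (ninf ginf : 'I_N -> R)
    (S0 : state R N d) (S : R -> state R N d)
    (Phi : R -> 'I_N -> 'rV[R]_d -> R)
    (hP : wf_params P) (hD : wf_geometry D)
    (same_diameter : forall i j : 'I_N, sigma P i = sigma P j)
    (hS0 : equilibrium P D Sigma ninf ginf S0)
    (hS_init : S 0 = S0)
    (hS_smooth : smooth_family D S)
    (hS : \forall t \near (0 : R),
       ek_solution P D (fun x => t *: f x) Sigma (fun x => t * Psiext x) (S t))
    (hPhi : \forall t \near (0 : R),
       ionic_potential P ninf ginf (fun x => t * Psiext x) (S t) (Phi t)) :
  let u : 'rV[R]_d -> 'rV[R]_d := first_variation (fun t => vel (S t)) in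
  let dp : 'rV[R]_d -> R := @first_variation R d R^o (fun t => pres (S t)) in
  let dPsi : 'rV[R]_d -> R := @first_variation R d R^o (fun t => pot (S t)) in
  let dPhi : 'I_N -> 'rV[R]_d -> R :=
    fun j => @first_variation R d R^o (fun t => Phi t j) in
  let Pr : 'rV[R]_d -> R := fun x =>
    dp x + \sum_j zR P j * conc S0 j x * (dPsi x + dPhi j x + Psiext x) in
  linearized_solution P D f Psiext (conc S0) u Pr dPhi.
Proof.
move=> u dp dPsi dPhi Pr.
have hs k : sigma P k = sigma P (Ordinal (N_gt0 hP)) by exact: same_diameter.
have [sol0 _ _ _ _ _] := hS0.
have n_gt0 j x : fluid_region D x -> 0 < conc (S 0) j x.
  rewrite hS_init; exact: (ek_conc_gt0 sol0).
have xi_lt1 x : fluid_region D x -> xi P (conc_at (S 0) x) < 1.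
  by rewrite hS_init => /(ek_xi sol0)/andP[].
have [Q [Oo OF [vk pk qk ck] C_gt0 C_xi]] := regular_domain hS_smooth n_gt0 xi_lt1.
exact: (linearized_solution_of_domain hP hD hs hS0 hS_init hS hPhi Oo OF vk pk qk ck).
Qed.
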